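(* Let $\mathcal{A}$ be a finite alphabet, $\Omega=\mathcal{A}^{\mathbb{N}}$ with the Borel $\sigma$-algebra generated by cylinders, $\sigma$ the shift, and $\mu$ a $\sigma$-invariant Borel probability measure on $\Omega$ (not necessarily ergodic). If $Z:\mathcal{A}^*\to\{0,1\}^*$ is an optimal reversible coding algorithm, then the functions $K_Z$, $\hat H$, $K$ are measurable and $$h_\mu(\sigma)=\int_\Omega K_Z(\omega)\,d\mu=\int_\Omega\hat H(\omega)\,d\mu=\int_\Omega K(\omega)\,d\mu.$$
   Context: $\omega^n$ is the string of the first $n$ symbols of $\omega$; $h_\mu(\sigma)$ is the Kolmogorov–Sinai entropy. Empirical entropy: for a finite string $s$ of length $n$ and $w\in\mathcal{A}^l$, $P(s,w)=\frac{1}{n-l+1}\#\{0\le i\le n-l: s_{i+1}\cdots s_{i+l}=w\}$, $\hat H_l(s)=-\frac1l\sum_{w}P(s,w)\log_2P(s,w)$; $\hat H_l(\omega)=\limsup_n\hat H_l(\omega^n)$, $\hat H(\omega)=\lim_{l}\hat H_l(\omega)$. A reversible coding algorithm is an injective recursive $Z:\mathcal{A}^*\to\{0,1\}^*$; it is optimal if for every $k$ there is $f_k$ with $f_k(n)=o(n)$ such that $|Z(s)|/|s|\le\hat H_k(s)+f_k(|s|)/|s|$ for all finite $s$. $K_Z(\omega)=\limsup_n|Z(\omega^n)|/n$. $AIC(s)=\min\{|P|:C(P)=s\}$ for a fixed universal machine $C$, and $K(\omega)=\limsup_n AIC(\omega^n)/n$. *)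

(* Defs.v *)
From HB Require Import structures.
From Stdlib Require List.
From mathcomp Require Import all_boot all_algebra.
From mathcomp Require Import all_classical all_reals all_analysis.
From mathcomp Require Import measurable_realfun.

Set Implicit Arguments.
Unset Strict Implicit.
Unset Printing Implicit Defensive.

Import GRing.Theory Num.Theory.
Local Open Scope classical_set_scope.
Local Open Scope ring_scope.

(** Codes of mu-recursive functions. Arguments are lists of naturals
    (missing arguments default to 0). *)
Inductive prf : Type :=
  | PZero : prf
  | PSucc : prf
  | PProj : nat -> prf
  | PComp : prf -> list prf -> prf
  | PRec  : prf -> prf -> prf
  | PMin  : prf -> prf.

Inductive prf_eval : prf -> list nat -> nat -> Prop :=
  | ev_zero v : prf_eval PZero v 0
  | ev_succ v : prf_eval PSucc v (S (List.hd 0%N v))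
  | ev_proj i v : prf_eval (PProj i) v (List.nth i v 0%N)
  | ev_comp f gs v ws y :
      List.Forall2 (fun g w => prf_eval g v w) gs ws ->
      prf_eval f ws y -> prf_eval (PComp f gs) v y
  | ev_rec0 f g v y :
      prf_eval f v y -> prf_eval (PRec f g) (0%N :: v) y
  | ev_recS f g n v z y :
      prf_eval (PRec f g) (n :: v) z ->
      prf_eval g (n :: z :: v) y -> prf_eval (PRec f g) (S n :: v) y
  | ev_min f v n :
      prf_eval f (n :: v) 0%N ->
      (forall m, (m < n)%N -> exists k, prf_eval f (m :: v) (S k)) ->
      prf_eval (PMin f) v n.

Definition recursive_fun (T U : countType) (f : T -> U) : Prop :=
  exists e : prf, forall (x : T) (y : nat),
    prf_eval e [:: pickle x] y <-> y = pickle (f x).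

Definition partial_recursive (T U : countType) (f : T -> option U) : Prop :=
  exists e : prf, forall (x : T) (y : nat),
    prf_eval e [:: pickle x] y <-> exists u, f x = Some u /\ y = pickle u.

Definition universal_machine (A : finType) (C : seq bool -> option (seq A))
  : Prop :=
  partial_recursive C /\
  forall D : seq bool -> option (seq A), partial_recursive D ->
    exists p : seq bool, forall P : seq bool, C (p ++ P) = D P.

(** Algorithmic information content AIC(s) = min{|P| : C(P) = s}
    (+oo if no program outputs s). *)
Definition AIC {R : realType} (A : finType) (C : seq bool -> option (seq A))
  (s : seq A) : \bar R :=
  ereal_inf [set ((size P)%:R)%:E | P in [set P | C P = Some s]].

Definition log2 {R : realType} (x : R) : R := ln x / ln 2.
Definition xlog2 {R : realType} (x : R) : R := if x == 0 then 0 else x * log2 x.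

Definition occ (A : finType) (l : nat) (s : seq A) (w : l.-tuple A) : nat :=
  \sum_(0 <= i < (size s - l).+1) (take l (drop i s) == val w).

Definition emp_freq {R : realType} (A : finType) (l : nat) (s : seq A)
  (w : l.-tuple A) : R :=
  (occ s w)%:R / ((size s - l).+1)%:R.

Definition emp_entropy {R : realType} (A : finType) (l : nat) (s : seq A) : R :=
  - (l%:R)^-1 * \sum_(w : l.-tuple A) xlog2 (emp_freq s w).

Definition optimal_coding {R : realType} (A : finType)
  (Z : seq A -> seq bool) : Prop :=
  forall k : nat, (0 < k)%N ->
    exists f : nat -> R,
      (fun n : nat => f n / n%:R) @ \oo --> (0 : R^o) /\
      forall s : seq A,
        (size (Z s))%:R / (size s)%:R <=
          emp_entropy k s + f (size s) / (size s)%:R.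

Definition reversible_coding (A : finType) (Z : seq A -> seq bool) : Prop :=
  injective Z /\ recursive_fun Z.

(** Nonempty finite alphabets (the space Omega must be inhabited). *)
HB.structure Definition FinPointed := {T of Finite T & isPointed T}.

Definition prefix (A : Type) (w : nat -> A) (n : nat) : seq A := mkseq w n.

Definition cylinders (A : FinPointed.type) : set (set (nat -> A)) :=
  [set B | exists s : seq A, B = [set w | prefix w (size s) = s]].

Definition Omega (A : FinPointed.type) : measurableType (sigma_display (@cylinders A)) := g_sigma_algebraType (@cylinders A).

Definition shift (A : FinPointed.type) (w : Omega A) : Omega A :=
  fun n => w n.+1.

Definition shift_invariant {R : realType} (A : FinPointed.type)
  (mu : probability (Omega A) R) : Prop :=
  forall B : set (Omega A), measurable B -> mu (@shift A @^-1` B) = mu B.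

Definition meas_partition (A : FinPointed.type) (k : nat)
  (P : 'I_k -> set (Omega A)) : Prop :=
  (forall i, measurable (P i)) /\
  (forall i j, i != j -> P i `&` P j = set0) /\
  (\bigcup_(i in [set: 'I_k]) P i = setT).

Definition join_iter (A : FinPointed.type) (k : nat)
  (P : 'I_k -> set (Omega A)) (n : nat) (w : n.-tuple 'I_k) : set (Omega A) :=
  \bigcap_(i in [set: 'I_n]) (iter i (@shift A) @^-1` P (tnth w i)).

Definition part_entropy {R : realType} (A : FinPointed.type) (I : finType)
  (mu : probability (Omega A) R) (Q : I -> set (Omega A)) : R :=
  - \sum_(j : I) xlog2 (fine (mu (Q j))).

Definition ks_entropy_part {R : realType} (A : FinPointed.type)
  (mu : probability (Omega A) R) (k : nat) (P : 'I_k -> set (Omega A))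
  : \bar R :=
  limn (fun n : nat => ((n%:R)^-1 * part_entropy mu (@join_iter A k P n))%:E).

Definition ks_entropy {R : realType} (A : FinPointed.type)
  (mu : probability (Omega A) R) : \bar R :=
  ereal_sup [set x | exists (k : nat) (P : 'I_k -> set (Omega A)),
                       meas_partition P /\ x = ks_entropy_part mu P].

Definition K_Z {R : realType} (A : FinPointed.type) (Z : seq A -> seq bool)
  (w : Omega A) : \bar R :=
  limn_esup (fun n : nat => ((size (Z (prefix w n)))%:R / n%:R : R)%:E).

Definition Hhat_l {R : realType} (A : FinPointed.type) (l : nat)
  (w : Omega A) : \bar R :=
  limn_esup (fun n : nat => (emp_entropy l (prefix w n) : R)%:E).

Definition Hhat {R : realType} (A : FinPointed.type) (w : Omega A) : \bar R :=
  limn (fun l : nat => (Hhat_l l w : \bar R)).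

Definition K_AIC {R : realType} (A : FinPointed.type)
  (C : seq bool -> option (seq A)) (w : Omega A) : \bar R :=
  limn_esup (fun n : nat => (AIC C (prefix w n) * ((n%:R)^-1 : R)%:E)%E).

(* Main.v *)
(** Write [h] for the limit of [H_n / n], the block entropy rate of the
    coordinate process.  Pointwise [K <= K_Z <= limsup_l Hhat_l]: the inverse of
    [Z] is partial recursive by unbounded search over the codes of words, and
    [Z] is optimal.  It remains to sandwich the integrals.
    - [\int Hhat <= h]: by the ergodic theorem (Keane and Petersen's proof) the
      empirical frequencies converge almost everywhere to the probabilities of a
      stationary law depending on the point, so [l * Hhat_l] is subadditive and
      [Hhat] is almost everywhere both a limit and a lower bound of the
      [Hhat_l]; Gibbs' inequality against the block law of [mu] bounds
      [\int Hhat_l], and replaces the ergodic decomposition.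
    - [h <= \int K]: shortest programs form an injective code, whose mean length
      on blocks of length [n] is at least [H_n - O(log n)]; conclude by the
      reverse Fatou lemma, which replaces the Shannon-McMillan-Breiman theorem.
    - [h] is the Kolmogorov-Sinai entropy: the labels of a measurable partition
      are approximated by functions of finitely many coordinates, and Gibbs'
      inequality bounds the loss by a conditional entropy tending to 0. *)

Require Import Defs.
From HB Require Import structures.
From mathcomp Require Import all_boot all_order all_algebra.
From mathcomp Require Import all_classical all_reals all_analysis.
From mathcomp Require Import measurable_realfun.
From mathcomp Require Import zify ring lra.
(* Reimported so that [shift] and [prefix] denote the definitions of Defs. *)
Import Defs.

Set Implicit Arguments.
Unset Strict Implicit.
Unset Printing Implicit Defensive.
Import Order.TTheory GRing.Theory Num.Theory.
Import numFieldNormedType.Exports.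
Local Open Scope classical_set_scope.
Local Open Scope ring_scope.

(** * Gibbs' inequality and block entropy *)

(** Two families of block weights obey the same [stationary] axioms: the block law of [mu] and, at
    almost every point, the limiting frequencies along the orbit. Gibbs' inequality and Fekete's
    lemma therefore serve both. Without ergodicity the frequencies at a point differ from [mu];
    coding all points with the single law (block law + uniform law) / 2 costs on average at most H_l
    + 1 bits per block of length l, and the extra bit disappears on division by l.

    Two features of the definitions shape the rest. Programs need not be prefix-free, so Kraft's
    inequality fails: it is replaced by the bound B + 1 on the sum of the weights 2^-|code| when all
    lengths are at most B, at the price of log2 (B + 1) bits. A bound B linear in n, which also
    provides the domination in Fatou's lemma, comes from optimality for blocks of length 1. Moreover
    [Hhat] is a [limn], hence a meaningless constant where the sequence diverges, so inequalities
    valid at every point are stated with the limit superior [Hsup], which equals [Hhat] almost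
    everywhere. *)

Section finite_entropy.
Context {R : realType}.
Implicit Types (x y : R) (I : finType).

Lemma ln2_gt0 : 0 < ln 2 :> R.
Proof. by apply: ln_gt0; rewrite ltr1n. Qed.

Lemma log2M x y : 0 < x -> 0 < y -> log2 (x * y) = log2 x + log2 y :> R.
Proof. by move=> x0 y0; rewrite /log2 lnM ?posrE// mulrDl. Qed.

Lemma log2V x : 0 < x -> log2 x^-1 = - log2 x :> R.
Proof. by move=> x0; rewrite /log2 lnV ?posrE// mulNr. Qed.

Lemma log2X n x : 0 < x -> log2 (x ^+ n) = n%:R * log2 x :> R.
Proof. by move=> x0; rewrite /log2 lnXn// mulr_natl mulrnAl. Qed.

Lemma log2_prod I (F : I -> R) :
  (forall i, 0 < F i) -> log2 (\prod_i F i) = \sum_i log2 (F i).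
Proof.
move=> F0.
suff [] : log2 (\prod_i F i) = \sum_i log2 (F i) /\ 0 < \prod_i F i by [].
apply: (big_ind2 (fun a b => log2 a = b /\ 0 < a)) => //.
- by split => //; rewrite /log2 ln1 mul0r.
- by move=> ? ? ? ? [<- ?] [<- ?]; rewrite log2M// mulr_gt0.
Qed.

Lemma log2_2 : log2 2 = 1 :> R.
Proof. by rewrite /log2 divff// gt_eqF// ln2_gt0. Qed.

Lemma ler_log2 x y : 0 < x -> x <= y -> log2 x <= log2 y :> R.
Proof.
move=> x0 xy; rewrite /log2 ler_pM2r ?invr_gt0 ?ln2_gt0// ler_ln// posrE.
exact: lt_le_trans xy.
Qed.

Lemma log2_le0 x : x <= 1 -> log2 x <= 0 :> R.
Proof.
by move=> x1; rewrite /log2 pmulr_lle0 ?invr_gt0 ?ln2_gt0// ln_le0.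
Qed.

Lemma xlog2E x : xlog2 x = x * log2 x.
Proof. by rewrite /xlog2; case: eqP => // ->; rewrite mul0r. Qed.

Lemma xlog2_le0 x : 0 <= x <= 1 -> xlog2 x <= 0.
Proof. by case/andP=> x0 x1; rewrite xlog2E mulr_ge0_le0// log2_le0. Qed.

(** This is ln x <= x - 1 at x = q i / p i, summed with weights p i. Asking only for an inequality
    between the total masses admits a defective [q], such as the weights of a code or conditional
    laws set to 0 on null events. *)
Lemma gibbs I (p q : I -> R) :
  (forall i, 0 <= p i) -> (forall i, 0 <= q i) ->
  (forall i, q i = 0 -> p i = 0) -> \sum_i q i <= \sum_i p i ->
  \sum_i p i * log2 (q i) <= \sum_i xlog2 (p i).
Proof.
move=> p0 q0 qp spq.
suff pt i : p i * log2 (q i) <= xlog2 (p i) + (q i - p i) / ln 2.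
  apply: (le_trans (ler_sum _ (fun i _ => pt i))).
  rewrite big_split/= gerDl -mulr_suml pmulr_lle0 ?invr_gt0 ?ln2_gt0//.
  by rewrite sumrB subr_le0.
rewrite xlog2E; have [pi0|pi_neq0] := eqVneq (p i) 0.
  by rewrite pi0 !mul0r add0r subr0 divr_ge0// ltW// ln2_gt0.
have pi_gt0 : 0 < p i by rewrite lt_neqAle eq_sym pi_neq0 p0.
have qi_gt0 : 0 < q i.
  rewrite lt_neqAle eq_sym q0 andbT; apply: contra pi_neq0 => /eqP/qp ->.
  by [].
rewrite /log2 !mulrA -mulrDl ler_pM2r ?invr_gt0 ?ln2_gt0//.
have lnD : ln (q i) = ln (p i) + ln (q i / p i).
  by rewrite -lnM ?posrE ?divr_gt0// mulrC divfK.
rewrite lnD mulrDr lerD2l.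
have : ln (q i / p i) <= q i / p i - 1.
  rewrite -[X in ln X](addrNK 1) addrC; apply: le_ln1Dx.
  by rewrite ltrBrDr addNr divr_gt0.
rewrite -(ler_pM2l pi_gt0) => /le_trans; apply.
by rewrite mulrBr mulr1 mulrCA divff// mulr1.
Qed.

(** The summand is a function of sequences, not of tuples, so that words of different lengths can be
    concatenated without casts. *)
Definition wsum I (l : nat) (f : seq I -> R) : R := \sum_(w : l.-tuple I) f w.

Lemma wsum0 I (f : seq I -> R) : wsum 0 f = f [::].
Proof.
rewrite /wsum (bigD1 [tuple])//= big1 ?addr0// => w /eqP[].
by rewrite tuple0.
Qed.

Lemma wsumS I l (f : seq I -> R) :
  wsum l.+1 f = \sum_a wsum l (fun w => f (a :: w)).
Proof.
rewrite /wsum pair_big/=.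
rewrite (reindex (fun x : I * l.-tuple I => cons_tuple x.1 x.2))//=.
exists (fun w => (thead w, behead_tuple w)) => [[a w] _|w _]/=.
  by congr (_, _); apply: val_inj.
by rewrite [RHS]tuple_eta; apply: val_inj.
Qed.

Lemma wsum_cat I l m (f : seq I -> R) :
  wsum (l + m) f = wsum l (fun u => wsum m (fun v => f (u ++ v))).
Proof.
elim: l f => [|l IH] f; first by rewrite wsum0.
by rewrite addSn !wsumS; apply: eq_bigr => a _; rewrite IH.
Qed.

Lemma eq_wsum I l (f g : seq I -> R) :
  (forall w, size w = l -> f w = g w) -> wsum l f = wsum l g.
Proof. by move=> fg; apply: eq_bigr => w _; rewrite fg// size_tuple. Qed.

Lemma wsumD I l (f g : seq I -> R) :
  wsum l (fun w => f w + g w) = wsum l f + wsum l g.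
Proof. exact: big_split. Qed.

Lemma wsumM I l c (f : seq I -> R) : wsum l (fun w => c * f w) = c * wsum l f.
Proof. by rewrite /wsum mulr_sumr. Qed.

Lemma wsumC I l m (f : seq I -> seq I -> R) :
  wsum l (fun u => wsum m (f u)) = wsum m (fun v => wsum l (f ^~ v)).
Proof. exact: exchange_big. Qed.

Lemma wsum_rcons I l (f : seq I -> R) :
  wsum l.+1 f = \sum_a wsum l (fun w => f (rcons w a)).
Proof.
rewrite -addn1 wsum_cat /wsum exchange_big /=.
rewrite -[LHS]/(wsum 1 (fun w => wsum l (fun u => f (u ++ w)))) wsumS.
by apply: eq_bigr => a _; rewrite wsum0; apply: eq_bigr => w _; rewrite cats1.
Qed.

(* The values [F w] are the probabilities of the blocks [w] under a stationary
   law on sequences. *)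
Definition stationary I (F : seq I -> R) : Prop :=
  [/\ forall w, 0 <= F w, F [::] = 1, forall w, \sum_a F (a :: w) = F w &
      forall w, \sum_a F (rcons w a) = F w].

Definition block_entropy I (F : seq I -> R) (l : nat) : R :=
  - wsum l (fun w => xlog2 (F w)).

Section stationary.
Context (I : finType) (F : seq I -> R) (sF : stationary F).

Lemma stationary_catl u m : wsum m (fun v => F (u ++ v)) = F u.
Proof.
case: sF => _ _ _ Fr; elim: m u => [|m IH] u; first by rewrite wsum0 cats0.
rewrite wsumS -[RHS]Fr; apply: eq_bigr => a _; rewrite -[RHS]IH.
by apply: eq_wsum => w _; rewrite cat_rcons.
Qed.

Lemma stationary_catr v l : wsum l (fun u => F (u ++ v)) = F v.
Proof.
case: sF => _ _ Fl _; elim: l v => [|l IH] v; first by rewrite wsum0.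
rewrite wsum_rcons -[RHS]Fl; apply: eq_bigr => a _; rewrite -[RHS]IH.
by apply: eq_wsum => w _; rewrite cat_rcons.
Qed.

Lemma stationary_sum1 l : wsum l F = 1.
Proof. by case: sF => _ F0 _ _; rewrite -F0 -(stationary_catl [::] l). Qed.

Lemma stationary_le_catl u v : F (u ++ v) <= F u.
Proof.
rewrite -(stationary_catl u (size v)) /wsum (bigD1 (in_tuple v))//= lerDl.
by case: sF => F0 _ _ _; apply: sumr_ge0 => *.
Qed.

Lemma stationary_le_catr u v : F (u ++ v) <= F v.
Proof.
rewrite -(stationary_catr v (size u)) /wsum (bigD1 (in_tuple u))//= lerDl.
by case: sF => F0 _ _ _; apply: sumr_ge0 => *.
Qed.

Lemma stationary_le1 w : 0 <= F w <= 1.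
Proof.
case: sF => F0 F1 _ _; rewrite F0/= -F1.
exact: (stationary_le_catl [::]).
Qed.

Lemma block_entropy_ge0 l : 0 <= block_entropy F l.
Proof.
rewrite oppr_ge0; apply: sumr_le0 => w _; apply: xlog2_le0.
exact: stationary_le1.
Qed.

(** Gibbs' inequality against the product law F u * F v on concatenations; by stationarity both
    marginals of the blocks of length l + m are given by [F]. *)
Lemma block_entropy_subadd l m :
  block_entropy F (l + m) <= block_entropy F l + block_entropy F m.
Proof.
have F0 w : 0 <= F w by case: sF.
rewrite /block_entropy -opprD lerN2.
pose q w := F (take l w) * F (drop l w).
have G : wsum (l + m) (fun w => F w * log2 (q w)) <=
         wsum (l + m) (fun w => xlog2 (F w)).
  apply: gibbs => // [w|w|]; first by rewrite mulr_ge0.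
    move=> qw0; apply/eqP; rewrite eq_le F0 andbT -[X in F X](cat_take_drop l).
    move/eqP: qw0; rewrite mulf_eq0 => /orP[/eqP <-|/eqP <-].
      exact: stationary_le_catl.
    exact: stationary_le_catr.
  rewrite [leLHS](_ : _ = wsum (l + m) q)// [leRHS](stationary_sum1 (l + m)).
  rewrite wsum_cat.
  rewrite (eq_wsum (g := fun u => F u * 1)) ?wsumM.
    by under eq_wsum do rewrite mulr1; rewrite stationary_sum1.
  move=> u ul; rewrite -(stationary_sum1 m) -wsumM; apply: eq_wsum => v _.
  by rewrite /q -ul take_size_cat// drop_size_cat.
apply: le_trans G; rewrite wsum_cat.
rewrite le_eqVlt; apply/orP; left; apply/eqP.
rewrite [RHS](eq_wsum (g := fun u => wsum m (fun v => F (u ++ v) * log2 (F u))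
   + wsum m (fun v => F (u ++ v) * log2 (F v)))).
  rewrite wsumD; congr (_ + _).
    apply: eq_wsum => u _; rewrite xlog2E -{1}(stationary_catl u m).
    by rewrite mulrC -wsumM; apply: eq_wsum => v _; rewrite mulrC.
  rewrite [RHS]wsumC.
  apply: eq_wsum => v _; rewrite xlog2E -{1}(stationary_catr v l).
  by rewrite mulrC -wsumM; apply: eq_wsum => u _; rewrite mulrC.
move=> u ul; rewrite -wsumD; apply: eq_wsum => v _.
rewrite -mulrDr /q -ul take_size_cat// drop_size_cat//.
have := F0 (u ++ v); rewrite le_eqVlt => /orP[/eqP <-|Fuv].
  by rewrite !mul0r.
rewrite log2M//; first exact: lt_le_trans (stationary_le_catl u v).
exact: lt_le_trans (stationary_le_catr u v).
Qed.

End stationary.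
End finite_entropy.

(** The limit is the infimum of a n / n over positive n, finite by nonnegativity. The lower bound
    matters as much as the convergence: it later compares [Hsup] with every [Hhat_l]. *)
Lemma fekete (R : realType) (a : nat -> R) :
  (forall n, 0 <= a n) -> (forall m n, a (m + n)%N <= a m + a n) ->
  exists L : R, (fun n => n%:R^-1 * a n) @ \oo --> L /\
    forall n, (0 < n)%N -> L <= n%:R^-1 * a n.
Proof.
move=> a0 aD.
pose S := [set (n.+1%:R)^-1 * a n.+1 | n in [set: nat]].
have Sb : has_lbound S.
  by exists 0 => _ [n _ <-]; rewrite mulr_ge0// invr_ge0.
have infS : has_inf S by split => //; exists (1%:R^-1 * a 1%N); exists 0%N.
have lb n : (0 < n)%N -> inf S <= n%:R^-1 * a n.
  by case: n => // n _; apply: ge_inf => //; exists n.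
exists (inf S); split => //.
apply/cvgrPdist_le => e e0.
have e20 : 0 < e / 2 by rewrite divr_gt0.
have [_ [m' _ <-] mlt] := inf_adherent e20 infS.
set m := m'.+1 in mlt.
(* A single bound for [a r] over all remainders modulo the nearly optimal [m]. *)
pose B := \sum_(r < m) a r.
have B0 : 0 <= B by apply: sumr_ge0.
have aq q r : a (q * m + r)%N <= q%:R * a m + a r.
  elim: q => [|q IH]; first by rewrite mul0n mul0r add0n add0r.
  rewrite mulSn -addnA -natr1 mulrDl mul1r addrAC.
  by apply: (le_trans (aD _ _)); rewrite [leRHS]addrC lerD2l.
exists (Num.truncn (B / (e / 2))).+1 => // n /= nB.
have n0 : (0 < n)%N by apply: leq_trans nB.
have nR0 : 0 < n%:R :> R by rewrite ltr0n.
rewrite distrC ger0_norm ?subr_ge0 ?lb//.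
have an : a n <= n%:R * (m%:R^-1 * a m) + B.
  rewrite {1}(divn_eq n m); apply: (le_trans (aq _ _)); apply: lerD.
    rewrite mulrA ler_wpM2r// ler_pdivlMr ?ltr0n//.
    by rewrite -natrM ler_nat leq_divM.
  rewrite /B (bigD1 (Ordinal (ltn_pmod n (ltn0Sn m'))))//= lerDl.
  exact: sumr_ge0.
have Bn : B <= n%:R * (e / 2).
  rewrite -ler_pdivrMr//; apply/ltW/(lt_le_trans (truncnS_gt _)).
  by rewrite ler_nat.
rewrite -(ler_pM2l nR0) mulrBr mulrA divff ?gt_eqF// mul1r lerBlDr.
apply: (le_trans an).
have : n%:R * (m%:R^-1 * a m) <= n%:R * (inf S + e / 2).
  by rewrite ler_pM2l// ltW.
rewrite mulrDr; move: Bn; set X := n%:R * (_ / 2).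
have -> : n%:R * e = X + X by rewrite /X -mulrDr -splitr.
by move=> *; lra.
Qed.

(** * Limits superior of sequences *)

Section limsup.
Context {R : realType}.
Implicit Types (u v : nat -> \bar R) (y : \bar R).
Local Open Scope ereal_scope.

Lemma limn_esup_inf u : limn_esup u = ereal_inf (range (esups u)).
Proof.
rewrite limn_esup_lim; apply: cvg_lim; first exact: ereal_hausdorff.
exact: cvg_esups_inf.
Qed.

Lemma limn_esup_le u y : (\forall n \near \oo, u n <= y) -> limn_esup u <= y.
Proof.
case=> N _ uy; rewrite limn_esup_inf; apply: (@le_trans _ _ (esups u N)).
  by apply: ereal_inf_lbound; exists N.
by apply: ge_ereal_sup => _ [n /= Nn <-]; exact: uy.
Qed.

Lemma limn_esup_ge u y :
  (forall N, exists2 n, (N <= n)%N & y <= u n) -> y <= limn_esup u.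
Proof.
move=> uy; rewrite limn_esup_inf; apply: le_ereal_inf_tmp => _ [N _ <-].
have [n Nn yu] := uy N; apply: le_trans yu _.
by apply: ereal_sup_ubound; exists n.
Qed.

Lemma limn_esup_lt u y : limn_esup u < y -> \forall n \near \oo, u n < y.
Proof.
rewrite limn_esup_inf => /ereal_inf_lt[_ [N _ <-] lt]; exists N => // n /= Nn.
by apply: le_lt_trans lt; apply: ereal_sup_ubound; exists n.
Qed.

Lemma limn_esup_gt u y :
  y < limn_esup u -> forall N, exists2 n, (N <= n)%N & y < u n.
Proof.
move=> lt N; apply: contrapT => nex; move: lt; rewrite ltNge => /negP; apply.
apply: limn_esup_le; exists N => // n /= Nn; rewrite leNgt; apply/negP => lt.
by apply: nex; exists n.
Qed.

(** Absorbs every vanishing error term of the proof. The sequences are real but their limits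
    superior may be infinite, so these cannot simply be subtracted. *)
Lemma limn_esup_le_add (u v e : nat -> R) :
  (\forall n \near \oo, (u n <= v n + e n)%R) -> e @ \oo --> (0 : R)%R ->
  limn_esup (fun n => (u n)%:E) <= limn_esup (fun n => (v n)%:E).
Proof.
move=> uv e0; set L := limn_esup (fun n => (v n)%:E).
have key (z y : R) : L < z%:E -> (z < y)%R ->
    limn_esup (fun n => (u n)%:E) <= y%:E.
  move=> /limn_esup_lt Lz zy; apply: limn_esup_le; near=> n.
  rewrite lee_fin.
  have /ltW v_z : (v n < z)%R by rewrite -lte_fin; near: n.
  have e_yz : (e n <= y - z)%R.
    apply: (le_trans (ler_norm _)); near: n.
    have /cvgr0_norm_le := e0; apply; by rewrite subr_gt0.
  have : (u n <= v n + e n)%R by near: n.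
  by move=> /le_trans; apply; lra.
move: key; case: L => [l| |] key; last 2 first.
- exact: leey.
- move: key; case: (limn_esup _) => [x| |] key //; last first.
    by have := key 0%R 1%R (ltNyr _) ltr01; rewrite leye_eq.
  have := key (x - 2)%R (x - 1)%R (ltNyr _); rewrite lee_fin => key'.
  have ? : (x <= x - 1)%R by apply: key'; lra.
  by exfalso; lra.
apply/lee_addgt0Pr => d d0; rewrite -EFinD; apply: (key (l + d / 2)%R).
  by rewrite lte_fin ltrDl divr_gt0.
by rewrite ltrD2l gtr_pMr// invf_lt1// ltr1n.
Unshelve. all: by end_near. Qed.

Lemma limn_esup_cvg (u : nat -> R) (l : R) : u @ \oo --> l ->
  limn_esup (fun n => (u n)%:E) = l%:E.
Proof.
move=> ul; have /cvg_limn_einf_sup[] // : (fun n => (u n)%:E) @ \oo --> l%:E.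
by apply: cvg_EFin => //; exact: nearW.
Qed.

End limsup.

Lemma invn_cvg0 (R : realType) (c : R) :
  (fun n : nat => c / n%:R) @ \oo --> (0 : R).
Proof.
apply/cvgr0Pnorm_le => e e0.
near=> n.
have n0 : 0 < n%:R :> R by rewrite ltr0n; near: n; exists 1%N.
rewrite normrM normfV (ger0_norm (ltW n0)) ler_pdivrMr// -ler_pdivrMl//.
near: n; exists (Num.truncn (e^-1 * `|c|)).+1 => // n /= nB.
apply/ltW/(lt_le_trans (truncnS_gt _)).
by rewrite ler_nat.
Unshelve. all: by end_near. Qed.

(** With s the square root of x, ln (1 / s) <= 1 / s gives x |ln x| <= 2 s. This yields both the
    continuity of [xlog2] at 0 and a uniform bound on empirical entropies. *)
Lemma xlog2_norm_le (R : realType) (x : R) :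
  0 <= x <= 1 -> `|xlog2 x| <= 2 * Num.sqrt x / ln 2.
Proof.
move=> /andP[x0 x1]; have l2 := @ln2_gt0 R.
rewrite ler0_norm ?xlog2_le0 ?x0// xlog2E.
move: x0; rewrite le_eqVlt => /orP[/eqP <-|x0].
  by rewrite mul0r oppr0 mulr_ge0// ?invr_ge0 ?ltW// mulr_ge0.
rewrite /log2 mulrA -mulNr ler_pM2r ?invr_gt0//.
have s0 : 0 < Num.sqrt x by rewrite sqrtr_gt0.
have E : x = Num.sqrt x ^+ 2 by rewrite sqr_sqrtr// ltW.
move: (Num.sqrt x) s0 E => s s0 ->.
have : ln s^-1 <= s^-1 by apply/ltW/ln_sublinear; rewrite invr_gt0.
rewrite lnV ?posrE// lnXn// -(ler_pM2l s0) mulfV ?gt_eqF// => H.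
rewrite (_ : - _ = (2 * s) * (s * - ln s)); first by rewrite ger_pMr// mulr_gt0.
by rewrite expr2 -mulr_natl; ring.
Qed.

Lemma cvg_xlog2 (R : realType) (u : nat -> R) (l : R) :
  (forall n, 0 <= u n) -> u @ \oo --> l ->
  (fun n => xlog2 (u n)) @ \oo --> xlog2 l.
Proof.
move=> u0 ul; have l0 : 0 <= l.
  rewrite -(cvg_lim _ ul)//; apply: limr_ge; first exact: cvgP ul.
  exact: nearW.
move: l0; rewrite le_eqVlt => /orP[/eqP l0|l0]; last first.
  rewrite xlog2E (_ : (fun _ => _) = (fun n => u n * (ln (u n) * (ln 2)^-1))).
    apply: cvgM => //; apply: cvgMr_tmp.
    exact: (continuous_cvg _ (continuous_ln l0) ul).
  by apply/funext => n; rewrite xlog2E.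
rewrite -l0 {2}/xlog2 eqxx; apply: norm_cvg0.
apply: (@squeeze_cvgr _ _ _ _ (cst 0) (fun n => 2 * Num.sqrt (u n) / ln 2)).
- have u1 : \forall n \near \oo, u n <= 1.
    by apply: (cvgr_le _ ul); rewrite -l0 ltr01.
  near=> n; rewrite normr_ge0/=; apply: xlog2_norm_le.
  by rewrite u0/=; near: n.
- exact: cvg_cst.
- rewrite (_ : 0 = 2 * Num.sqrt l / ln 2 :> R); last first.
    by rewrite -l0 sqrtr0 mulr0 mul0r.
  apply: cvgMr_tmp; apply: cvgMl_tmp.
  exact: (continuous_cvg _ (@sqrt_continuous R l) ul).
Unshelve. all: by end_near. Qed.

Lemma cvg_near_eq (R : realType) (u v : nat -> R) (l : R) :
  (\forall n \near \oo, u n = v n) -> u @ \oo --> l -> v @ \oo --> l.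
Proof. by move=> uv; apply: cvg_trans; apply: near_eq_cvg. Qed.

Lemma cvg_sumr (R : realType) (I : finType) (u : I -> nat -> R) (l : I -> R) :
  (forall i, u i @ \oo --> l i) ->
  (fun n => \sum_i u i n) @ \oo --> \sum_i l i.
Proof.
move=> ul.
elim: (index_enum I) => [|i r IH].
  by rewrite big_nil; under eq_fun do rewrite big_nil; exact: cvg_cst.
by rewrite big_cons; under eq_fun do rewrite big_cons; apply: cvgD.
Qed.

(** * Laws of finitely valued random variables *)

Section finite_random_variable.
Context d (T : measurableType d) (R : realType) (mu : probability T R).
Implicit Types I J : finType.
Local Open Scope ereal_scope.

Definition finite_rv I (X : T -> I) : Prop :=
  forall j, measurable (X @^-1` [set j]).

Definition law I (X : T -> I) (j : I) : R := fine (mu (X @^-1` [set j])).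

Lemma measurable_finite_rv I (X : T -> I) (S : set I) :
  finite_rv X -> measurable (X @^-1` S).
Proof.
move=> mX; rewrite (_ : _ @^-1` _ = \bigcup_(j in S) (X @^-1` [set j])).
  exact: fin_bigcup_measurable.
apply/seteqP; split=> [x Sx|x [j Sj /= Xj]]; first by exists (X x).
by rewrite Xj.
Qed.

Lemma finite_rv_comp I J (X : T -> I) (h : I -> J) :
  finite_rv X -> finite_rv (h \o X).
Proof. by move=> mX j; rewrite comp_preimage; apply: measurable_finite_rv. Qed.

Lemma finite_rv_pair I J (X : T -> I) (Y : T -> J) :
  finite_rv X -> finite_rv Y -> finite_rv (fun x => (X x, Y x)).
Proof.
move=> mX mY [i j].
rewrite (_ : _ @^-1` _ = X @^-1` [set i] `&` Y @^-1` [set j]).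
  exact: measurableI.
by apply/seteqP; split=> x /= [-> ->].
Qed.

Lemma measurable_fun_finite_rv I (X : T -> I) d' (U : measurableType d')
    (f : I -> U) :
  finite_rv X -> measurable_fun setT (f \o X).
Proof.
move=> mX _ B mB; rewrite setTI comp_preimage; exact: measurable_finite_rv.
Qed.

Lemma measure_finite_rv I (X : T -> I) (B : set T) :
  finite_rv X -> measurable B ->
  mu B = \sum_(j : I) mu (B `&` X @^-1` [set j]).
Proof.
move=> mX mB.
have mBX j : measurable (B `&` X @^-1` [set j]) by apply: measurableI.
transitivity (\int[mu]_x (\1_B x)%:E); first by rewrite integral_indic// setIT.
rewrite [RHS](eq_bigr (fun j =>
    \int[mu]_x (\1_(B `&` X @^-1` [set j]) x)%:E)); last first.
  by move=> j _; rewrite integral_indic// setIT.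
rewrite -ge0_integral_sum//; last first.
  by move=> j; apply/measurable_EFinP; exact: measurable_indic.
apply: eq_integral => x _; rewrite sumEFin; congr EFin.
rewrite (bigD1 (X x))//= big1 ?addr0.
  rewrite !indicE; congr ((_ : bool)%:R)%R.
  by apply/idP/idP; rewrite !inE /=; [split|case].
by move=> j /eqP jX; rewrite indicE memNset//= => -[_ /esym].
Qed.

Lemma lawE I (X : T -> I) j :
  finite_rv X -> mu (X @^-1` [set j]) = (law X j)%:E.
Proof. by move=> mX; rewrite fineK// fin_num_measure. Qed.

Lemma law_ge0 I (X : T -> I) j : (0 <= law X j)%R.
Proof. exact: fine_ge0. Qed.

Lemma measure_finite_rv_set I (X : T -> I) (S : pred I) :
  finite_rv X -> mu (X @^-1` [set j | S j]) = (\sum_(j | S j) law X j)%:E.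
Proof.
move=> mX; rewrite (measure_finite_rv mX); last exact: measurable_finite_rv.
rewrite -sumEFin [RHS]big_mkcond/=; apply: eq_bigr => j _.
case: ifPn => [Sj|nSj].
  rewrite -lawE//; congr (mu _); apply/seteqP; split=> [x []//|x /= Xj].
  by split=> //; rewrite /= Xj.
rewrite (_ : _ `&` _ = set0) ?measure0//.
by apply/seteqP; split=> // x [/= + Xj]; rewrite Xj (negPf nSj).
Qed.

Lemma law_comp I J (X : T -> I) (h : I -> J) i :
  finite_rv X -> law (h \o X) i = (\sum_(j | h j == i) law X j)%R.
Proof.
move=> mX; rewrite /law (_ : _ @^-1` _ = X @^-1` [set j | h j == i]).
  by rewrite (measure_finite_rv_set (fun j => h j == i)).
by apply/seteqP; split=> x /= /eqP.
Qed.

Lemma sum_law_comp I J (X : T -> I) (h : I -> J) (f : J -> R) :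
  finite_rv X ->
  (\sum_i law (h \o X) i * f i)%R = (\sum_j law X j * f (h j))%R.
Proof.
move=> mX; rewrite [RHS](partition_big h predT)//=; apply: eq_bigr => i _.
rewrite (law_comp _ _ mX) mulr_suml.
by apply: eq_bigr => j /eqP <-.
Qed.

Lemma sum_law I (X : T -> I) : finite_rv X -> (\sum_i law X i)%R = 1%R.
Proof.
move=> mX; apply: EFin_inj; have := measure_finite_rv_set predT mX.
rewrite (_ : _ @^-1` _ = setT) ?probability_setT => [<-//|].
by apply/seteqP; split.
Qed.

Lemma integral_finite_rv I (X : T -> I) (f : I -> R) :
  finite_rv X -> (forall i, 0 <= f i)%R ->
  \int[mu]_x (f (X x))%:E = (\sum_i law X i * f i)%:E.
Proof.
move=> mX f0.
pose g i (x : T) : \bar R := (f i)%:E * (\1_(X @^-1` [set i]) x)%:E.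
have mind i : measurable_fun setT (fun x => (\1_(X @^-1` [set i]) x : R)%:E).
  by apply/measurable_EFinP; exact: measurable_indic.
rewrite (eq_integral (fun x => \sum_i g i x)).
  rewrite ge0_integral_sum//; last 2 first.
  - by move=> i; apply: measurable_funeM.
  - by move=> i x _; rewrite /g mule_ge0// lee_fin.
  rewrite -sumEFin; apply: eq_bigr => i _.
  rewrite ge0_integralZl_EFin//.
  rewrite integral_indic// setIT EFinM muleC; congr (_ * _); exact: lawE.
move=> x _; rewrite (bigD1 (X x))//= big1 ?adde0.
  by rewrite /g indicE mem_set//= mule1.
move=> j /eqP jX; rewrite /g indicE memNset ?mule0//=.
by move=> Xj; apply: jX.
Qed.

End finite_random_variable.

(** * Itineraries under the shift and their block laws *)

Section blocks.
Context (R : realType) (A : FinPointed.type) (mu : probability (Omega A) R).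
Context (mu_inv : shift_invariant mu).
Implicit Types (I : finType).

Definition head0 (w : Omega A) : A := w 0%N.

Definition itinerary I (Y : Omega A -> I) (n : nat) (w : Omega A) : seq I :=
  mkseq (fun i => Y (iter i (@shift A) w)) n.

Lemma size_itinerary I (Y : Omega A -> I) n w : size (itinerary Y n w) == n.
Proof. by rewrite size_mkseq. Qed.

Definition itin I (Y : Omega A -> I) n w : n.-tuple I :=
  Tuple (size_itinerary Y n w).

Lemma iter_shiftE n (w : Omega A) k : iter n (@shift A) w k = w (n + k)%N.
Proof. by elim: n k => //= n IH k; rewrite /shift IH addnS. Qed.

Lemma itinerary_head0 n (w : Omega A) : itinerary head0 n w = prefix w n.
Proof.
by apply: eq_map => i; rewrite /head0 iter_shiftE addn0.
Qed.

Lemma itineraryS I (Y : Omega A -> I) n w :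
  itinerary Y n.+1 w = Y w :: itinerary Y n (shift w).
Proof.
rewrite /itinerary /mkseq/= (iotaDl 1 0) -map_comp; congr cons.
by apply: eq_map => i /=; rewrite -iterSr.
Qed.

Lemma itinerarySr I (Y : Omega A -> I) n w :
  itinerary Y n.+1 w = rcons (itinerary Y n w) (Y (iter n (@shift A) w)).
Proof. by rewrite /itinerary mkseqS. Qed.

Lemma itinerary_cat I (Y : Omega A -> I) m n w :
  itinerary Y (m + n) w =
  itinerary Y m w ++ itinerary Y n (iter m (@shift A) w).
Proof.
elim: m w => [|m IH] w //.
by rewrite addSn !itineraryS IH -iterSr.
Qed.

Lemma finite_rv_prefix n : finite_rv (itin head0 n).
Proof.
move=> s; apply: sub_sigma_algebra; exists s; apply/seteqP.
rewrite size_tuple; split=> w /=; first by move=> <-; rewrite -itinerary_head0.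
by rewrite -itinerary_head0 => E; apply: val_inj.
Qed.

Arguments finite_rv_prefix n _ : clear implicits.

Lemma measurable_fun_prefix d (U : measurableType d) n (f : seq A -> U) :
  measurable_fun setT (fun w : Omega A => f (prefix w n)).
Proof.
have -> : (fun w : Omega A => f (prefix w n)) = (f \o val) \o itin head0 n.
  by apply/funext => w /=; rewrite itinerary_head0.
exact: (measurable_fun_finite_rv (f \o val) (finite_rv_prefix n)).
Qed.

Lemma finite_rv_head0 : finite_rv head0.
Proof.
have -> : head0 = @thead 0 A \o itin head0 1 by apply/funext.
exact: finite_rv_comp (finite_rv_prefix 1).
Qed.

Lemma measurable_shift : measurable_fun setT (@shift A).
Proof.
apply: (@measurability _ _ (Omega A) (Omega A) _ _ (@cylinders A) erefl).
move=> _ [_ [s ->] <-].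
rewrite setTI (_ : _ @^-1` _ = itin head0 (size s).+1 @^-1`
  [set t | behead t = s]).
  exact: measurable_finite_rv (finite_rv_prefix _).
have E w : behead (itin head0 (size s).+1 w) = prefix (shift w) (size s).
  change (behead (itinerary head0 (size s).+1 w) = prefix (shift w) (size s)).
  by rewrite itineraryS -itinerary_head0.
by apply/funext => w; rewrite /preimage /mkset E.
Qed.

Lemma measurable_iter_shift n : measurable_fun setT (iter n (@shift A)).
Proof.
elim: n => [|n IH]; first exact: measurable_id.
exact: (measurableT_comp measurable_shift IH).
Qed.

Lemma measurable_shift_preimage n (B : set (Omega A)) :
  measurable B -> measurable (iter n (@shift A) @^-1` B).
Proof.
by move=> mB; rewrite -[X in measurable X]setTI; apply: measurable_iter_shift.
Qed.

Lemma measure_iter_shift n (B : set (Omega A)) :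
  measurable B -> mu (iter n (@shift A) @^-1` B) = mu B.
Proof.
move=> mB; elim: n => [|n IH]//; rewrite -IH -[in RHS]mu_inv.
  by congr (mu _); apply/seteqP; split=> w /=; rewrite -iterSr.
exact: measurable_shift_preimage.
Qed.

Lemma finite_rv_shift n I (Y : Omega A -> I) :
  finite_rv Y -> finite_rv (Y \o iter n (@shift A)).
Proof.
by move=> mY j; rewrite comp_preimage; apply: measurable_shift_preimage.
Qed.

Lemma law_shift n I (Y : Omega A -> I) :
  finite_rv Y -> law mu (Y \o iter n (@shift A)) = law mu Y.
Proof.
by move=> mY; apply/funext => j; rewrite /law comp_preimage measure_iter_shift.
Qed.

Lemma finite_rv_itin I (Y : Omega A -> I) n :
  finite_rv Y -> finite_rv (itin Y n).
Proof.
move=> mY; elim: n => [|n IH].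
  move=> t; rewrite (_ : _ @^-1` _ = setT)//.
  by apply/seteqP; split=> // w _ /=; rewrite [t]tuple0 [LHS]tuple0.
have -> : itin Y n.+1 = (fun x : I * n.-tuple I => cons_tuple x.1 x.2) \o
    (fun w => (Y w, (itin Y n \o iter 1 (@shift A)) w)).
  by apply/funext => w; apply: val_inj; rewrite /= itineraryS.
by apply/finite_rv_comp/finite_rv_pair => //; apply: finite_rv_shift.
Qed.

Definition block_law I (Y : Omega A -> I) (s : seq I) : R :=
  fine (mu [set w | itinerary Y (size s) w = s]).

Lemma block_lawE I (Y : Omega A -> I) n (t : n.-tuple I) :
  block_law Y t = law mu (itin Y n) t.
Proof.
rewrite /block_law /law size_tuple; congr (fine (mu _)); apply/seteqP.
by split=> w /= => [E|<-//]; apply: val_inj.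
Qed.

(** Summation over the last label is additivity of [mu] alone; summation over the first label uses
    invariance as well. *)
Lemma block_law_stationary I (Y : Omega A -> I) :
  finite_rv Y -> stationary (block_law Y).
Proof.
move=> mY.
have mS s : measurable [set w | itinerary Y (size s) w = s].
  rewrite (_ : [set _ | _] = itin Y (size s) @^-1` [set in_tuple s]).
    exact: finite_rv_itin.
  by apply/seteqP; split=> w /= => [E|/(congr1 val)//]; apply: val_inj.
have bE s : mu [set w | itinerary Y (size s) w = s] = (block_law Y s)%:E.
  by rewrite fineK// fin_num_measure.
split.
- by move=> s; apply: fine_ge0.
- rewrite /block_law (_ : [set _ | _] = setT) ?probability_setT//.
  by apply/seteqP; split.
- move=> s; apply: EFin_inj; rewrite -sumEFin -bE -(mu_inv (mS s)).
  rewrite [RHS](measure_finite_rv mu mY); last first.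
    exact: (measurable_shift_preimage 1).
  apply: eq_bigr => a _; rewrite -bE; congr (mu _); apply/seteqP.
  split=> w /=; rewrite ?itineraryS; first by case.
  by case=> -> ->.
- move=> s; apply: EFin_inj; rewrite -sumEFin -bE.
  rewrite [RHS](measure_finite_rv mu (finite_rv_shift (size s) mY))//.
  apply: eq_bigr => a _; rewrite -bE; congr (mu _); apply/seteqP.
  split=> w /=; rewrite size_rcons itinerarySr.
    by move/rcons_inj => [].
  by case=> -> ->.
Qed.

Lemma part_entropy_itin I (Y : Omega A -> I) n :
  part_entropy mu (fun t : n.-tuple I => itin Y n @^-1` [set t]) =
  block_entropy (block_law Y) n.
Proof.
by congr -%R; apply: eq_bigr => t _; rewrite block_lawE.
Qed.

End blocks.
Arguments finite_rv_prefix {A} n _.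
Arguments finite_rv_itin {A I Y} n _ _.

(** * The ergodic theorem *)

Section birkhoff.
Context (R : realType) (A : FinPointed.type) (mu : probability (Omega A) R).
Context (mu_inv : shift_invariant mu).
Implicit Types (f g : Omega A -> R) (w : Omega A).
Local Notation T := (@shift A).

Definition birkhoff_sum f n w : R := \sum_(i < n) f (iter i T w).

Lemma birkhoff_sumD f m n w :
  birkhoff_sum f (m + n) w = birkhoff_sum f m w + birkhoff_sum f n (iter m T w).
Proof.
rewrite /birkhoff_sum big_split_ord/=; congr (_ + _).
by apply: eq_bigr => i _; rewrite addnC iterD.
Qed.

Lemma birkhoff_sum1 f w : birkhoff_sum f 1 w = f w.
Proof. exact: big_ord1. Qed.

Lemma birkhoff_sum_ge0 f n w : (forall w, 0 <= f w) -> 0 <= birkhoff_sum f n w.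
Proof. by move=> f0; apply: sumr_ge0. Qed.

Lemma le_birkhoff_sum f g n w :
  (forall w, f w <= g w) -> birkhoff_sum f n w <= birkhoff_sum g n w.
Proof. by move=> fg; apply: ler_sum. Qed.

Lemma birkhoff_sum_cst c n w : birkhoff_sum (cst c) n w = n%:R * c.
Proof. by rewrite /birkhoff_sum sumr_const card_ord mulr_natl. Qed.

Lemma birkhoff_sum_shift f n w :
  birkhoff_sum f n (T w) = birkhoff_sum f n w + f (iter n T w) - f w.
Proof.
apply/eqP; rewrite eq_sym subr_eq eq_sym addrC -(birkhoff_sum1 f w).
rewrite -(birkhoff_sumD f 1) add1n -addn1 birkhoff_sumD.
by rewrite [birkhoff_sum f 1 (iter _ _ _)]birkhoff_sum1.
Qed.

Lemma measurable_birkhoff_sum f n :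
  measurable_fun setT f -> measurable_fun setT (birkhoff_sum f n).
Proof.
move=> mf; apply: measurable_sum => i.
exact: (measurableT_comp mf (@measurable_iter_shift A i)).
Qed.

Lemma integral_iter_shift n (f : Omega A -> \bar R) :
  measurable_fun setT f -> (forall w, 0 <= f w)%E ->
  (\int[mu]_w f (iter n T w) = \int[mu]_w f w)%E.
Proof.
move=> mf f0.
have H := @ge0_integral_pushforward _ _ _ _ _ _ (@measurable_iter_shift A n) mu
  setT f measurableT mf (fun w _ => f0 w).
rewrite preimage_setT in H; rewrite -H; apply: eq_measure_integral.
  exact: measurable_iter_shift.
by move=> ? B mB _; exact: measure_iter_shift.
Qed.

Lemma integral_birkhoff_sum f n :
  measurable_fun setT f -> (forall w, 0 <= f w) ->
  (\int[mu]_w (birkhoff_sum f n w)%:E = n%:R%:E * \int[mu]_w (f w)%:E)%E.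
Proof.
move=> mf f0.
have mfi i : measurable_fun setT (fun w => (f (iter i T w))%:E).
  apply/measurable_EFinP.
  exact: (measurableT_comp mf (@measurable_iter_shift A i)).
under eq_integral do rewrite /birkhoff_sum -sumEFin.
rewrite (ge0_integral_sum _ _ (fun i : 'I_n => mfi i))//; last first.
  by move=> i w _; rewrite lee_fin.
rewrite (eq_bigr (fun=> \int[mu]_w (f w)%:E)%E); last first.
  move=> i _; apply: (@integral_iter_shift i (fun w => (f w)%:E)) => //.
  exact/measurable_EFinP.
by rewrite sumr_const card_ord; elim: n => [|n IH]; rewrite ?mul0e// mulrS IH
  -natr1 addrC EFinD ge0_muleDl ?lee_fin// mul1e addeC.
Qed.

(* The orbit segment is cut greedily into blocks of length at most [N] on which the
   average is at least [g]; only the last [N] terms are lost. *)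
Lemma birkhoff_sum_stitch f g N :
  (forall w, 0 <= f w) -> (forall w, 0 <= g w) ->
  (forall n w, g (iter n T w) = g w) ->
  (forall w, exists n, [/\ (0 < n)%N, (n <= N)%N &
     n%:R * g w <= birkhoff_sum f n w]) ->
  forall L w, (L - N)%N%:R * g w <= birkhoff_sum f L w.
Proof.
move=> f0 g0 gT H; elim/ltn_ind => L IH w.
have [LN|NL] := leqP L N.
  by rewrite (eqP LN) mul0r birkhoff_sum_ge0.
have [n [n0 nN Hn]] := H w.
rewrite -(subnKC (leq_trans nN (ltnW NL))) birkhoff_sumD.
apply: le_trans (lerD Hn (IH _ _ (iter n T w))); last by lia.
by rewrite gT -mulrDl -natrD ler_wpM2r// ler_nat; lia.
Qed.

(** By invariance, integration turns the hypothesis into (L - N) \int g <= L \int f; the loss of N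
    terms vanishes for large L. *)
Lemma integral_le_of_stitch f g N :
  measurable_fun setT f -> measurable_fun setT g ->
  (forall w, 0 <= f w) -> (forall w, 0 <= g w) -> (forall w, g w <= 1) ->
  (forall L w, (L - N)%N%:R * g w <= birkhoff_sum f L w) ->
  (\int[mu]_w (g w)%:E <= \int[mu]_w (f w)%:E)%E.
Proof.
move=> mf mg f0 g0 g1 H.
have fi0 : (0 <= \int[mu]_w (f w)%:E)%E.
  by apply: integral_ge0 => w _; rewrite lee_fin.
have gi0 : (0 <= \int[mu]_w (g w)%:E)%E.
  by apply: integral_ge0 => w _; rewrite lee_fin.
have gi1 : (\int[mu]_w (g w)%:E <= 1)%E.
  rewrite -(@probability_setT _ _ _ mu) -[X in mu X]setIT.
  rewrite -(integral_indic mu measurableT)//.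
  apply: ge0_le_integral => //.
  - by move=> w _; rewrite lee_fin.
  - exact/measurable_EFinP.
  - by apply/measurable_EFinP; exact: measurable_indic.
  - by move=> w _; rewrite lee_fin indicE in_setT.
have ineq L : ((L - N)%N%:R%:E * \int[mu]_w (g w)%:E <=
               L%:R%:E * \int[mu]_w (f w)%:E)%E.
  rewrite -(integral_birkhoff_sum L mf f0) -ge0_integralZl_EFin//; last 2 first.
  - by move=> w _; rewrite lee_fin.
  - exact/measurable_EFinP.
  apply: ge0_le_integral => //.
  - by move=> w _; rewrite mule_ge0// lee_fin.
  - by apply: measurable_funeM; exact/measurable_EFinP.
  - by apply/measurable_EFinP; exact: measurable_birkhoff_sum.
  - by move=> w _; rewrite -EFinM lee_fin.
have gfin : (\int[mu]_w (g w)%:E)%E \is a fin_num.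
  by rewrite ge0_fin_numE// (le_lt_trans gi1)// ltry.
move: ineq fi0 gi0 gi1; rewrite -(fineK gfin); set b := fine _.
case: (\int[mu]_w (f w)%:E)%E => [a ineq|_ _ _ _|_ //]; last by rewrite leey.
rewrite !lee_fin => a0 b0 b1; rewrite leNgt; apply/negP => ab.
have ba0 : 0 < b - a by rewrite subr_gt0.
(* Chosen so that L (b - a) > N, against the consequence L (b - a) <= N b <= N of [ineq]. *)
pose L := (N + (Num.truncn (N%:R / (b - a))).+1)%N.
have := ineq L; rewrite -!EFinM lee_fin natrB ?leq_addr// mulrBl lerBlDr.
rewrite -lerBlDl -mulrBr; apply/negP; rewrite -ltNge.
apply: (@le_lt_trans _ _ N%:R); first by rewrite ler_piMr.
rewrite -ltr_pdivrMr//; apply: (lt_le_trans (truncnS_gt _)).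
by rewrite ler_nat leq_addl.
Qed.

Definition upper_average f w : \bar R :=
  limn_esup (fun n => (birkhoff_sum f n w / n%:R)%:E).

Lemma measurable_upper_average f :
  measurable_fun setT f -> measurable_fun setT (upper_average f).
Proof.
move=> mf; apply: measurable_fun_limn_esup => n; apply/measurable_EFinP.
apply: measurable_funM; last exact: measurable_cst.
exact: measurable_birkhoff_sum.
Qed.

Section bounded.
Context (f : Omega A -> R) (mf : measurable_fun setT f).
Context (f01 : forall w, 0 <= f w <= 1).

Let f0 w : 0 <= f w. Proof. by case/andP: (f01 w). Qed.
Let f1 w : f w <= 1. Proof. by case/andP: (f01 w). Qed.

Lemma upper_average_ge0 w : (0 <= upper_average f w)%E.
Proof.
apply: limn_esup_ge => N; exists N => //.
by rewrite lee_fin divr_ge0// birkhoff_sum_ge0.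
Qed.

Lemma upper_average_le1 w : (upper_average f w <= 1)%E.
Proof.
apply: limn_esup_le; apply: nearW => -[|n].
  by rewrite invr0 mulr0.
rewrite lee_fin ler_pdivrMr// mul1r -[leRHS]mulr1 -(birkhoff_sum_cst _ _ w).
exact: le_birkhoff_sum.
Qed.

Lemma upper_average_fin_num w : upper_average f w \is a fin_num.
Proof.
rewrite ge0_fin_numE ?upper_average_ge0//.
by apply: (le_lt_trans (upper_average_le1 w)); rewrite ltry.
Qed.

Lemma upper_average_shift w : upper_average f (T w) = upper_average f w.
Proof.
have e0 := @invn_cvg0 R 1.
apply/eqP; rewrite eq_le; apply/andP; split;
    apply: limn_esup_le_add e0; apply: nearW => n;
    rewrite -mulrDl ler_wpM2r ?invr_ge0// birkhoff_sum_shift.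
  by rewrite -addrA lerD2l lerBlDr (le_trans (f1 _))// lerDl.
by have := f1 w; have := f0 (iter n T w); lra.
Qed.

Lemma upper_average_iter n w : upper_average f (iter n T w) = upper_average f w.
Proof. by elim: n => //= n IH; rewrite upper_average_shift. Qed.

(** The function [g], just below the upper average, is invariant and is beaten by some finite
    average at each point. The length needed is bounded by a common N off a set of small measure,
    where [f] is modified before stitching. *)
Lemma integral_upper_average_le :
  (\int[mu]_w upper_average f w <= \int[mu]_w (f w)%:E)%E.
Proof.
apply/lee_addgt0Pr => e e0; have e20 : 0 < e / 2 by rewrite divr_gt0.
(* The maximum with 0 keeps [g] nonnegative, as stitching requires. *)
pose g w := Num.max 0 (fine (upper_average f w) - e / 2).
have mg : measurable_fun setT g.
  apply: measurable_maxr; first exact: measurable_cst.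
  apply: measurable_funB; last exact: measurable_cst.
  exact: (measurableT_comp (fine_measurable measurableT)
            (measurable_upper_average mf)).
have g0 w : 0 <= g w by rewrite le_max lexx.
have g1 w : g w <= 1.
  have : fine (upper_average f w) <= 1.
    by rewrite -lee_fin fineK ?upper_average_fin_num// upper_average_le1.
  by rewrite ge_max ler01/= => ?; lra.
have gT n w : g (iter n T w) = g w by rewrite /g upper_average_iter.
pose E N := [set w | exists2 n, (n <= N)%N &
  n.+1%:R * g w <= birkhoff_sum f n.+1 w].
have mE N : measurable (E N).
  have -> : E N = \bigcup_(n in `I_N.+1)
      (setT `&` [set w | n.+1%:R * g w <= birkhoff_sum f n.+1 w]).
    apply/seteqP; split=> w; first by case=> n nN H; exists n.
    by case=> n /= nN [_ H]; exists n.
  apply: fin_bigcup_measurable => // n _; apply: measurable_fun_le => //.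
    by apply: measurable_funM => //; exact: measurable_cst.
  exact: measurable_birkhoff_sum.
have EU : \bigcup_N E N = setT.
  apply/seteqP; split=> // w _.
  suff [n Hn] : exists n, n.+1%:R * g w <= birkhoff_sum f n.+1 w.
    by exists n => //; exists n.
  have [fe|fe] := leP (fine (upper_average f w) - e / 2) 0.
    exists 0%N; rewrite /g (max_idPl fe) mulr0; exact: birkhoff_sum_ge0.
  have lt : ((fine (upper_average f w) - e / 2)%:E < upper_average f w)%E.
    rewrite -[X in (_ < X)%E]fineK ?upper_average_fin_num// lte_fin.
    by rewrite ltrBlDr ltrDl.
  have [[//|n] _] := limn_esup_gt lt 1%N.
  rewrite lte_fin ltr_pdivlMr// => /ltW; rewrite mulrC => H; exists n.
  by rewrite /g (max_idPr (ltW fe)).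
(* The sets [E N] increase to the whole space, so continuity of [mu] from below applies. *)
have [N muN] : exists N, (mu (~` E N) <= (e / 2)%:E)%E.
  have cvE : (mu \o E) @ \oo --> mu (\bigcup_N E N).
    apply: nondecreasing_cvg_mu => //; first by rewrite EU.
    move=> m n mn; apply/subsetPset => w [k km Hk].
    by exists k => //; exact: leq_trans mn.
  rewrite EU probability_setT in cvE.
  have lt1 : ((1 - e / 2)%:E < 1%:E)%E.
    by rewrite lte_fin ltrBlDr ltrDl.
  rewrite -(cvg_limn_einf_sup cvE).2 in lt1.
  have [N _ /= ltN] := limn_esup_gt lt1 0%N; exists N.
  rewrite probability_setC//; move: ltN.
  rewrite -(fineK (fin_num_measure mu _ (mE N))) lte_fin -EFinB lee_fin => ?.
  by lra.
(* Adding 1 off [E N] makes blocks of length 1 sufficient there, because g <= 1; the integral grows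
   by at most e / 2. *)
pose f' w := f w + \1_(~` E N) w.
have mI : measurable_fun setT (\1_(~` E N) : Omega A -> R).
  by apply: measurable_indic; exact: measurableC.
have mf' : measurable_fun setT f' by apply: measurable_funD.
have f'0 w : 0 <= f' w by rewrite addr_ge0.
have gf' : (\int[mu]_w (g w)%:E <= \int[mu]_w (f' w)%:E)%E.
  apply: (@integral_le_of_stitch _ _ N.+1) => //.
  apply: birkhoff_sum_stitch => // w.
  have [Ew|nEw] := pselect (E N w).
    case: Ew => n nN Hn; exists n.+1; split => //.
    by apply: (le_trans Hn); apply: le_birkhoff_sum => v; rewrite lerDl.
  exists 1%N; split => //; rewrite birkhoff_sum1 mul1r (le_trans (g1 w))//.
  by rewrite /f' indicE mem_set// lerDr.
rewrite (splitr e) EFinD addeA.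
apply: (@le_trans _ _ (\int[mu]_w (g w)%:E + (e / 2)%:E)%E); last first.
  rewrite leeD2r//; apply: (le_trans gf').
  under eq_integral do rewrite /f' EFinD.
  rewrite ge0_integralD//; last 3 first.
  - by move=> w _; rewrite lee_fin.
  - exact/measurable_EFinP.
  - exact/measurable_EFinP.
  by rewrite leeD2l// integral_indic// ?setIT//; exact: measurableC.
have ic : (\int[mu]_w (e / 2)%:E = (e / 2)%:E)%E.
  rewrite integral_cst// -[RHS]mule1; congr (_ * _)%E.
  exact: probability_setT.
have me : measurable_fun setT (fun w : Omega A => (e / 2)%:E) by [].
have mgE : measurable_fun setT (fun w => (g w)%:E) by exact/measurable_EFinP.
rewrite -ic -(ge0_integralD mu measurableT _ mgE _ me); last 2 first.
- by move=> w _; rewrite lee_fin.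
- by move=> w _; rewrite lee_fin ltW.
apply: ge0_le_integral => //.
- by move=> w _; exact: upper_average_ge0.
- exact: measurable_upper_average.
- exact: emeasurable_funD.
- move=> w _; rewrite -(fineK (upper_average_fin_num w)) -EFinD lee_fin.
  by rewrite -lerBlDr le_max lexx orbT.
Qed.

End bounded.
End birkhoff.

(** * Almost everywhere convergence of the averages *)

Section birkhoff_theorem.
Context (R : realType) (A : FinPointed.type) (mu : probability (Omega A) R).
Context (mu_inv : shift_invariant mu).
Context (f : Omega A -> R) (mf : measurable_fun setT f).
Context (f01 : forall w, 0 <= f w <= 1).

Let h w := 1 - f w.

Let mh : measurable_fun setT h.
Proof. by apply: measurable_funB => //; exact: measurable_cst. Qed.

Let h01 w : 0 <= h w <= 1.
Proof. by have := f01 w; rewrite /h; lra. Qed.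

Let U w := fine (upper_average f w).
Let V w := fine (upper_average h w).

Let UE w : upper_average f w = (U w)%:E.
Proof. by rewrite fineK// upper_average_fin_num. Qed.

Let VE w : upper_average h w = (V w)%:E.
Proof. by rewrite fineK// upper_average_fin_num. Qed.

Let avg_h n w : (0 < n)%N ->
  birkhoff_sum h n w / n%:R = 1 - birkhoff_sum f n w / n%:R.
Proof.
move=> n0; rewrite /birkhoff_sum sumrB sumr_const card_ord mulrBl divff//.
by rewrite pnatr_eq0 -lt0n.
Qed.

Let near_avg e w : 0 < e -> \forall n \near \oo,
  1 - V w - e < birkhoff_sum f n w / n%:R < U w + e.
Proof.
move=> e0.
have lt1 : (upper_average f w < (U w + e)%:E)%E by rewrite UE lte_fin ltrDl.
have lt2 : (upper_average h w < (V w + e)%:E)%E by rewrite VE lte_fin ltrDl.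
near=> n.
have : birkhoff_sum f n w / n%:R < U w + e.
  by rewrite -lte_fin; near: n; exact: limn_esup_lt lt1.
have : birkhoff_sum h n w / n%:R < V w + e.
  by rewrite -lte_fin; near: n; exact: limn_esup_lt lt2.
rewrite avg_h; last by near: n; exists 1%N.
by move=> ? ?; apply/andP; split; lra.
Unshelve. all: by end_near. Qed.

Let UV1 w : 1 <= U w + V w.
Proof.
rewrite leNgt; apply/negP => lt.
have e0 : 0 < (1 - U w - V w) / 2 by rewrite divr_gt0//; lra.
by case: (near_avg w e0) => N _ /(_ N (leqnn N)) /andP[]; lra.
Qed.

Let integral01 (g : Omega A -> R) : measurable_fun setT g ->
  (forall w, 0 <= g w) -> (forall w, g w <= 2) ->
  exists2 r : R, (\int[mu]_w (g w)%:E)%E = r%:E & 0 <= r.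
Proof.
move=> mg g0 g2.
have i0 : (0 <= \int[mu]_w (g w)%:E)%E.
  by apply: integral_ge0 => w _; rewrite lee_fin.
have i2 : (\int[mu]_w (g w)%:E <= 2%:E)%E.
  have <- : (\int[mu]_w (2%:E : \bar R) = 2%:E)%E.
    rewrite integral_cst// -[RHS]mule1; congr (_ * _)%E.
    exact: probability_setT.
  apply: ge0_le_integral => //; last by move=> w _; rewrite lee_fin.
    by move=> w _; rewrite lee_fin.
  exact/measurable_EFinP.
exists (fine (\int[mu]_w (g w)%:E)%E); last exact: fine_ge0.
by rewrite fineK// ge0_fin_numE// (le_lt_trans i2)// ltry.
Qed.

(** The maximal bound is applied to [f] and to [1 - f]. The lower average of [f] is [1 - V], so
    [U + V - 1] is nonnegative; its integral is at most \int f + \int (1 - f) - 1 = 0, hence it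
    vanishes almost everywhere. *)
Lemma birkhoff : exists F : Omega A -> R,
  [/\ measurable_fun setT F, forall w, 0 <= F w <= 1,
      (\int[mu]_w (F w)%:E = \int[mu]_w (f w)%:E)%E &
      {ae mu, forall w, (fun n => birkhoff_sum f n w / n%:R) @ \oo --> F w}].
Proof.
have U01 w : 0 <= U w <= 1.
  by rewrite -!lee_fin -UE upper_average_ge0// upper_average_le1.
have V01 w : 0 <= V w <= 1.
  by rewrite -!lee_fin -VE upper_average_ge0// upper_average_le1.
have mU : measurable_fun setT U.
  exact: (measurableT_comp (fine_measurable measurableT)
            (measurable_upper_average mf)).
have mV : measurable_fun setT V.
  exact: (measurableT_comp (fine_measurable measurableT)
            (measurable_upper_average mh)).
pose k w := U w + V w - 1.
have mk : measurable_fun setT k.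
  by apply: measurable_funB; [exact: measurable_funD|exact: measurable_cst].
have [u uE u0] : exists2 r : R, (\int[mu]_w (U w)%:E)%E = r%:E & 0 <= r.
  by apply: integral01 => // w; have := U01 w; lra.
have [v vE v0] : exists2 r : R, (\int[mu]_w (V w)%:E)%E = r%:E & 0 <= r.
  by apply: integral01 => // w; have := V01 w; lra.
have [a aE a0] : exists2 r : R, (\int[mu]_w (f w)%:E)%E = r%:E & 0 <= r.
  by apply: integral01 => // w; have := f01 w; lra.
have [b bE b0] : exists2 r : R, (\int[mu]_w (h w)%:E)%E = r%:E & 0 <= r.
  by apply: integral01 => // w; have := h01 w; lra.
have [c cE c0] : exists2 r : R, (\int[mu]_w (k w)%:E)%E = r%:E & 0 <= r.
  by apply: integral01 => // w; have := U01 w; have := V01 w; have := UV1 w;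
    rewrite /k; lra.
have i1 : (\int[mu]_w (1%:E : \bar R) = 1%:E)%E.
  rewrite integral_cst// -[RHS]mule1; congr (_ * _)%E.
  exact: probability_setT.
have intD (g1 g2 : Omega A -> R) : measurable_fun setT g1 ->
    measurable_fun setT g2 -> (forall w, 0 <= g1 w) -> (forall w, 0 <= g2 w) ->
    (\int[mu]_w (g1 w + g2 w)%:E =
     \int[mu]_w (g1 w)%:E + \int[mu]_w (g2 w)%:E)%E.
  move=> mg1 mg2 g10 g20; under eq_integral do rewrite EFinD.
  rewrite ge0_integralD//; try exact/measurable_EFinP.
    by move=> w _; rewrite lee_fin.
  by move=> w _; rewrite lee_fin.
have abE : a + b = 1.
  apply: EFin_inj; rewrite EFinD -aE -bE -i1 -intD//.
  - by apply: eq_integral => w _; rewrite /h addrC subrK.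
  - by move=> w; have := f01 w; lra.
  - by move=> w; have := h01 w; lra.
have uvE : u + v = c + 1.
  apply: EFin_inj; rewrite !EFinD -uE -vE -cE -i1 -!intD//.
  - by apply: eq_integral => w _; rewrite /k subrK.
  - by move=> w; have := UV1 w; rewrite /k; lra.
  - by move=> w; have := U01 w; lra.
  - by move=> w; have := V01 w; lra.
have ua : u <= a.
  rewrite -lee_fin -uE -aE; under eq_integral do rewrite -UE.
  exact: integral_upper_average_le.
have vb : v <= b.
  rewrite -lee_fin -vE -bE; under eq_integral do rewrite -VE.
  exact: integral_upper_average_le.
exists U; split => //; first by rewrite uE aE; congr EFin; lra.
have /ae_eq_integral_abs : (\int[mu]_w `|(k w)%:E| = 0)%E.
  under eq_integral => w _.
    rewrite gee0_abs; last by rewrite lee_fin /k subr_ge0.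
    over.
  by rewrite cE; congr EFin; lra.
have mkE : measurable_fun setT (fun w => (k w)%:E) by exact/measurable_EFinP.
move=> /(_ measurableT mkE); apply: filterS => w /(_ Logic.I)[kw].
apply/cvgrPdist_lt => e e0; near=> n.
have /andP[] : 1 - V w - e < birkhoff_sum f n w / n%:R < U w + e.
  by near: n; exact: near_avg.
by move: kw; rewrite /k => ? ? ?; rewrite ltr_distl; apply/andP; split; lra.
Unshelve. all: by end_near. Qed.

End birkhoff_theorem.

(** * Empirical entropies *)

Lemma emp_freq01 (R : realType) (A : finType) l (s : seq A)
    (t : l.-tuple A) :
  0 <= emp_freq (R := R) s t <= 1.
Proof.
rewrite /emp_freq divr_ge0//= ler_pdivrMr// mul1r ler_nat /occ.
apply: (@leq_trans (\sum_(0 <= i < (size s - l).+1) 1)).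
  by apply: leq_sum => i _; exact: leq_b1.
by rewrite sum_nat_const_nat muln1 subn0.
Qed.

Lemma emp_entropy_ge0 (R : realType) (A : finType) l (s : seq A) :
  0 <= emp_entropy (R := R) l s.
Proof.
rewrite /emp_entropy mulNr oppr_ge0 mulr_ge0_le0 ?invr_ge0//.
by apply: sumr_le0 => t _; apply: xlog2_le0; exact: emp_freq01.
Qed.

Section empirical_entropy.
Context (R : realType) (A : FinPointed.type) (mu : probability (Omega A) R).
Context (mu_inv : shift_invariant mu).
Implicit Types (w : Omega A) (s : seq A).

Definition cyl_ind s w : R := (prefix w (size s) == s)%:R.

Lemma measurable_cyl_ind s : measurable_fun setT (cyl_ind s).
Proof. exact: (measurable_fun_prefix (size s) (fun t => (t == s)%:R : R)). Qed.

Lemma cyl_ind01 s w : 0 <= cyl_ind s w <= 1.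
Proof. by rewrite ler0n lern1 leq_b1. Qed.

Lemma prefixS n w : prefix w n.+1 = w 0%N :: prefix (shift w) n.
Proof. by rewrite -!itinerary_head0 itineraryS. Qed.

Lemma prefixSr n w : prefix w n.+1 = rcons (prefix w n) (w n).
Proof. exact: mkseqS. Qed.

Lemma cyl_ind_cons s w : \sum_a cyl_ind (a :: s) w = cyl_ind s (shift w).
Proof.
rewrite (bigD1 (w 0%N))//= big1 ?addr0 => [|a aw]; rewrite /cyl_ind prefixS.
  by rewrite eqseq_cons eqxx.
by rewrite eqseq_cons eq_sym (negPf aw).
Qed.

Lemma cyl_ind_rcons s w : \sum_a cyl_ind (rcons s a) w = cyl_ind s w.
Proof.
rewrite (bigD1 (w (size s)))//= big1 ?addr0 => [|a aw];
  rewrite /cyl_ind size_rcons prefixSr eqseq_rcons.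
  by rewrite eqxx andbT.
by rewrite (eq_sym (w _)) (negPf aw) andbF.
Qed.

Lemma integral_cyl_ind s :
  (\int[mu]_w (cyl_ind s w)%:E = (block_law mu (@head0 A) s)%:E)%E.
Proof.
rewrite (block_lawE mu (@head0 A) (in_tuple s)).
under eq_integral => w _.
  rewrite (_ : cyl_ind s w = (itin (@head0 A) (size s) w == in_tuple s)%:R).
    over.
  by rewrite /cyl_ind -itinerary_head0.
rewrite (integral_finite_rv mu (f := fun t => (t == in_tuple s)%:R))//;
    last first.
  exact: finite_rv_prefix.
rewrite (bigD1 (in_tuple s))//= eqxx mulr1 big1 ?addr0// => t /negPf ->.
by rewrite mulr0.
Qed.

Lemma occ_prefix n l w (t : l.-tuple A) : (l <= n)%N ->
  (occ (prefix w n) t)%:R = birkhoff_sum (cyl_ind t) (n - l).+1 w.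
Proof.
move=> ln; rewrite /occ size_mkseq big_mkord natr_sum.
apply: eq_bigr => i _; rewrite /cyl_ind size_tuple; congr ((_ == _)%:R).
have : (i + l <= n)%N by have := ltn_ord i; lia.
move: (nat_of_ord i) => {}i il.
rewrite -[in RHS]itinerary_head0 -(subnKC il) -itinerary_head0 -addnA.
rewrite itinerary_cat drop_size_cat ?size_mkseq// itinerary_cat.
by rewrite take_size_cat ?size_mkseq.
Qed.

Lemma cvg_birkhoff_sum_shift (f : Omega A -> R) w (l : R) :
  (forall w, 0 <= f w <= 1) ->
  (fun n => birkhoff_sum f n w / n%:R) @ \oo --> l ->
  (fun n => birkhoff_sum f n (shift w) / n%:R) @ \oo --> l.
Proof.
move=> f01 fl.
suff H : (fun n => (f (iter n (@shift A) w) - f w) / n%:R) @ \oo --> (0 : R).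
  rewrite -[l]addr0 (_ : (fun _ => _) = (fun n => birkhoff_sum f n w / n%:R +
    (f (iter n (@shift A) w) - f w) / n%:R)); first exact: cvgD.
  by apply/funext => n; rewrite birkhoff_sum_shift -mulrDl addrA.
apply: norm_cvg0; apply: (@squeeze_cvgr _ _ _ _ (cst 0) (fun n => 1 / n%:R)).
- apply: nearW => n; rewrite normr_ge0/= normrM normfV [ `|n%:R| ]ger0_norm//.
  rewrite ler_wpM2r ?invr_ge0// ler_norml.
  by have := f01 w; have := f01 (iter n (@shift A) w); lra.
- exact: cvg_cst.
- exact: invn_cvg0.
Qed.

(** The axioms pass to the limit from identities between cylinder indicators: extending [s] on the
    right partitions its cylinder, extending it on the left partitions the shifted one, and a shift
    does not change limits of averages. *)
Lemma stationary_frequencies (F : seq A -> R) w :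
  (forall s, (fun n => birkhoff_sum (cyl_ind s) n w / n%:R) @ \oo --> F s) ->
  stationary F.
Proof.
move=> Fw.
have cvg_unique (u : nat -> R) (a b : R) :
    u @ \oo --> a -> u @ \oo --> b -> a = b.
  by move=> ua ub; rewrite -(cvg_lim _ ua)// -(cvg_lim _ ub).
have cvgsum (g : A -> seq A) :
    (fun n => birkhoff_sum (fun w => \sum_a cyl_ind (g a) w) n w / n%:R) @ \oo
    --> \sum_a F (g a).
  rewrite (_ : (fun _ => _) = (fun n =>
      \sum_a birkhoff_sum (cyl_ind (g a)) n w / n%:R)).
    by apply: cvg_sumr => a; exact: Fw.
  by apply/funext => n; rewrite -mulr_suml; congr (_ * _); exact: exchange_big.
split.
- move=> s; rewrite -(cvg_lim _ (Fw s))//; apply: limr_ge.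
    exact: cvgP (Fw s).
  apply: nearW => n; apply: divr_ge0 => //; apply: birkhoff_sum_ge0 => v.
  by case/andP: (cyl_ind01 s v).
- apply: (cvg_unique _ _ _ (Fw [::])); apply/cvgrPdist_le => e e0.
  exists 1%N => // n /= n0.
  rewrite (_ : birkhoff_sum _ _ _ = n%:R).
    by rewrite divff ?subrr ?normr0 ?ltW// pnatr_eq0 -lt0n.
  by rewrite /birkhoff_sum /cyl_ind /= sumr_const card_ord.
- move=> s; apply: (cvg_unique _ _ _ (cvgsum _)).
  apply: cvg_near_eq (cvg_birkhoff_sum_shift (cyl_ind01 s) (Fw s)).
  apply: nearW => n; congr (_ / _).
  by apply: eq_bigr => i _; rewrite cyl_ind_cons -iterS -iterSr.
- move=> s; apply: (cvg_unique _ _ _ (cvgsum _)).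
  apply: cvg_near_eq (Fw s); apply: nearW => n.
  by congr (_ / _); apply: eq_bigr => i _; rewrite cyl_ind_rcons.
Qed.

Lemma Hhat_l_frequencies (F : seq A -> R) w l :
  (forall s, (fun n => birkhoff_sum (cyl_ind s) n w / n%:R) @ \oo --> F s) ->
  Hhat_l l w = (l%:R^-1 * block_entropy F l)%:E.
Proof.
move=> Fw; apply: limn_esup_cvg.
rewrite /emp_entropy /block_entropy mulrN -mulNr; apply: cvgMl_tmp.
apply: cvg_sumr => t.
have H := cvg_xlog2 _ (Fw t).
have {}H : (fun n => xlog2 (birkhoff_sum (cyl_ind t) n w / n%:R)) @ \oo -->
    xlog2 (F t).
  apply: H => n; apply: divr_ge0 => //; apply: birkhoff_sum_ge0 => v.
  by case/andP: (cyl_ind01 t v).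
(* A word of length n has n - l + 1 windows of length l, so the averages are taken along this
   subsequence. *)
have S : (fun n => (n - l).+1) @ \oo --> \oo.
  move=> P [N _ NP]; exists (N + l)%N => // n /= Nn.
  by apply: NP => /=; lia.
apply: cvg_near_eq (cvg_comp _ _ S H); exists l => // n /= ln.
rewrite /emp_freq size_mkseq; congr (xlog2 (_ / _)).
by rewrite occ_prefix.
Qed.

(** Words are countably many, so one null set serves for all of them; [pickle] reindexes them by
    [nat] for the countable intersection. The limits depend on the point, and only their means are
    tied to [mu]. *)
Lemma empirical_frequencies : exists F : seq A -> Omega A -> R,
  [/\ forall s, measurable_fun setT (F s), forall s w, 0 <= F s w <= 1,
      forall s, (\int[mu]_w (F s w)%:E = (block_law mu (@head0 A) s)%:E)%E &
      {ae mu, forall w, stationary (F ^~ w) /\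
        forall l, Hhat_l l w = (l%:R^-1 * block_entropy (F ^~ w) l)%:E}].
Proof.
have [F HF] := choice (fun s =>
  birkhoff mu_inv (measurable_cyl_ind s) (cyl_ind01 s)).
exists F; split.
- by move=> s; case: (HF s).
- by move=> s; case: (HF s).
- by move=> s; case: (HF s) => _ _ -> _; exact: integral_cyl_ind.
have : {ae mu, forall w, forall k s, unpickle k = Some s ->
    (fun n => birkhoff_sum (cyl_ind s) n w / n%:R) @ \oo --> F s w}.
  apply: ae_foralln => k; case: (unpickle k) => [s|]; last by apply: aeW.
  by case: (HF s) => _ _ _; apply: filterS => w H _ [<-].
apply: filterS => w H.
have Fw s : (fun n => birkhoff_sum (cyl_ind s) n w / n%:R) @ \oo --> F s w.
  by apply: (H (pickle s)); rewrite pickleK.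
split; first exact: stationary_frequencies Fw.
by move=> l; apply: Hhat_l_frequencies.
Qed.

Lemma measurable_Hhat_l l : measurable_fun setT (@Hhat_l R A l).
Proof.
apply: measurable_fun_limn_esup => n.
exact: (measurable_fun_prefix n (fun s => (emp_entropy l s)%:E)).
Qed.

Lemma Hhat_l_ge0 l w : (0 <= Hhat_l (R := R) l w)%E.
Proof.
by apply: limn_esup_ge => N; exists N => //; rewrite lee_fin emp_entropy_ge0.
Qed.

(** Gibbs' inequality at almost every point against one fixed law [q] gives a bound [G] that is
    linear in the frequencies; its integral therefore involves only their means, which are the block
    probabilities of [mu]. *)
Lemma integral_Hhat_l_le l : (\int[mu]_w Hhat_l l w <=
  (l%:R^-1 * (block_entropy (block_law mu (@head0 A)) l + 1))%:E)%E.
Proof.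
have [F [mF F01 intF aeF]] := empirical_frequencies.
set p := block_law mu (@head0 A).
have sp : stationary p.
  by apply: block_law_stationary => //; exact: finite_rv_head0.
have p0 s : 0 <= p s by case: sp.
have A0 : (0 < #|A|)%N by apply/card_gt0P; exists point.
pose c : R := (#|A| ^ l)%:R^-1.
have c0 : 0 < c by rewrite invr_gt0 ltr0n expn_gt0 A0.
(* Mixing in the uniform law on words of length [l] makes [q] positive, so Gibbs' inequality applies
   even at points whose frequencies charge words of [mu]-measure 0. *)
pose q s := (p s + c) / 2.
have q0 s : 0 < q s by rewrite divr_gt0// ltr_wpDl.
have q1 : wsum l q = 1.
  rewrite /q /wsum -mulr_suml big_split/= sumr_const card_tuple.
  rewrite [X in X + _](stationary_sum1 sp l) -[c *+ _]mulr_natl mulfV.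
    by rewrite divff.
  by rewrite pnatr_eq0 expn_eq0 -[#|A| == _]negbK -lt0n A0.
have cle s : size s = l -> q s <= 1.
  move=> sl; rewrite ler_pdivrMr// mul1r.
  have := stationary_le1 sp s => /andP[_ ?].
  suff : c <= 1 by lra.
  by rewrite invf_le1 ?ltr0n ?expn_gt0 ?A0// ler1n expn_gt0 A0.
pose G w := l%:R^-1 * wsum l (fun s => F s w * - log2 (q s)).
have lq s : size s = l -> 0 <= - log2 (q s).
  by move=> sl; rewrite oppr_ge0 log2_le0// cle.
have FlE0 (t : l.-tuple A) w : 0 <= F t w * - log2 (q t).
  by rewrite mulr_ge0 ?lq ?size_tuple//; case/andP: (F01 t w).
have mFl (t : l.-tuple A) : measurable_fun setT (fun w => F t w * - log2 (q t)).
  by apply: measurable_funM; [exact: mF|exact: measurable_cst].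
have G0 w : 0 <= G w by rewrite mulr_ge0 ?invr_ge0//; apply: sumr_ge0.
have mW : measurable_fun setT (fun w => wsum l (fun s => F s w * - log2 (q s))).
  exact: measurable_sum.
have mG : measurable_fun setT G.
  by apply: measurable_funM => //; exact: measurable_cst.
apply: (@le_trans _ _ (\int[mu]_w (G w)%:E)%E).
  apply: ae_ge0_le_integral => //.
  - by move=> w _; exact: Hhat_l_ge0.
  - exact: measurable_Hhat_l.
  - by move=> w _; rewrite lee_fin.
  - exact/measurable_EFinP.
  apply: filterS aeF => w [sF ->] _; rewrite lee_fin ler_wpM2l ?invr_ge0//.
  rewrite /block_entropy lerNl /wsum -sumrN.
  under eq_bigr do rewrite mulrN opprK.
  apply: gibbs => [t|t|t|].
  - by case/andP: (F01 t w).
  - exact: ltW.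
  - by move=> qt; have := q0 t; rewrite qt ltxx.
  - by rewrite [leLHS]q1 [leRHS](stationary_sum1 sF l).
rewrite /G; under eq_integral do rewrite EFinM.
rewrite ge0_integralZl_EFin ?invr_ge0//; last 2 first.
- by move=> w _; rewrite lee_fin sumr_ge0.
- exact/measurable_EFinP.
rewrite EFinM; apply: lee_wpmul2l; first by rewrite lee_fin invr_ge0.
under eq_integral do rewrite /wsum -sumEFin.
rewrite (ge0_integral_sum mu measurableT (I := l.-tuple A)
  (f := fun t w => (F t w * - log2 (q t))%:E)); last 2 first.
- by move=> t; exact/measurable_EFinP.
- by move=> t w _; rewrite lee_fin.
rewrite (eq_bigr (fun t : l.-tuple A => (p t * - log2 (q t))%:E)); last first.
  move=> t _; under eq_integral do rewrite mulrC EFinM.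
  rewrite ge0_integralZl_EFin ?lq ?size_tuple//; last 2 first.
  - by move=> w _; rewrite lee_fin; case/andP: (F01 t w).
  - by apply/measurable_EFinP; exact: mF.
  by rewrite intF -EFinM mulrC.
rewrite sumEFin lee_fin -(stationary_sum1 sp l) /block_entropy /wsum -sumrN.
rewrite -big_split/=; apply: ler_sum => t _.
have := p0 t; rewrite le_eqVlt => /orP[/eqP <-|pt].
  by rewrite mul0r addr0 xlog2E mul0r oppr0.
rewrite (_ : - xlog2 (p t) + p t = p t * (1 - log2 (p t))); last first.
  by rewrite xlog2E mulrBr mulr1 addrC.
rewrite ler_pM2l//.
(* The mixture costs at most one bit per block, which is the [+ 1] in the bound. *)
have : log2 (p t * 2^-1) <= log2 (q t) :> R.
  by apply: ler_log2; rewrite ?divr_gt0// ler_pM2r ?invr_gt0// lerDl ltW.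
by rewrite log2M ?invr_gt0// log2V// log2_2; lra.
Qed.
End empirical_entropy.

(** * The cylinder partition generates *)

Section rv_entropy.
Context d (T : measurableType d) (R : realType) (mu : probability T R).
Implicit Types I J : finType.

Definition rv_entropy I (X : T -> I) : R := - \sum_j xlog2 (law mu X j).

Lemma law_le_comp I J (X : T -> I) (h : I -> J) j :
  finite_rv X -> law mu X j <= law mu (h \o X) (h j).
Proof.
move=> mX; rewrite (law_comp mu _ _ mX) (bigD1 j)//= lerDl.
by apply: sumr_ge0 => i _; exact: law_ge0.
Qed.

Lemma rv_entropy_comp I J (X : T -> I) (h : I -> J) :
  finite_rv X -> rv_entropy (h \o X) <= rv_entropy X.
Proof.
move=> mX; rewrite lerN2.
under [leRHS]eq_bigr do rewrite xlog2E.
rewrite (sum_law_comp mu h (fun i => log2 (law mu (h \o X) i)) mX).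
apply: ler_sum => j _; rewrite xlog2E.
have := law_ge0 mu X j; rewrite le_eqVlt => /orP[/eqP <-|p0].
  by rewrite !mul0r.
by rewrite ler_pM2l// ler_log2// law_le_comp.
Qed.

Lemma law_dist I (X X' : T -> I) (E : set T) (e : R) j :
  finite_rv X -> finite_rv X' -> measurable E -> (mu E <= e%:E)%E ->
  (forall x, ~ E x -> X x = X' x) -> `|law mu X j - law mu X' j| <= e.
Proof.
move=> mX mX' mE muE XX'.
have key (Y Y' : T -> I) : finite_rv Y -> finite_rv Y' ->
    (forall x, ~ E x -> Y x = Y' x) -> law mu Y j <= law mu Y' j + e.
  move=> mY mY' YY'; rewrite -lee_fin EFinD -!lawE//.
  apply: (@le_trans _ _ (mu (Y' @^-1` [set j] `|` E))).
    apply: le_measure; rewrite ?inE//; first exact: measurableU.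
    move=> x /= <-; have [Ex|nEx] := pselect (E x); [by right|left].
    by rewrite /= YY'.
  by apply: (le_trans (measureU2 _ _ _)) => //; rewrite leeD2l.
have := key _ _ mX mX' XX'.
have := key _ _ mX' mX (fun x nEx => esym (XX' x nEx)).
by rewrite ler_norml; lra.
Qed.

End rv_entropy.

Section generator.
Context (R : realType) (A : FinPointed.type) (mu : probability (Omega A) R).
Context (mu_inv : shift_invariant mu).
Implicit Types (w : Omega A) (s : seq A) (B : set (Omega A)).

Lemma take_prefix m n w : (m <= n)%N -> take m (prefix w n) = prefix w m.
Proof.
move=> mn; rewrite -!itinerary_head0 -(subnKC mn) itinerary_cat.
by rewrite take_size_cat// size_mkseq.
Qed.

(** Stated as agreement off an exceptional set, so that approximations of several events are
    combined by uniting their exceptional sets. *)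
Definition approximable B : Prop := forall e : R, 0 < e ->
  exists N (S : seq A -> bool) E, [/\ measurable E, (mu E <= e%:E)%E &
    forall w, ~ E w -> (B w <-> S (prefix w N))].

Lemma approximableC B : approximable B -> approximable (~` B).
Proof.
move=> aB e e0; have [N [S [E [mE muE H]]]] := aB e e0.
exists N, (fun s => ~~ S s), E; split=> // w /H BS; split => /=.
  by move=> nB; apply/negP => /BS.
by move=> /negP nS /BS.
Qed.

Lemma approximableU B C :
  approximable B -> approximable C -> approximable (B `|` C).
Proof.
move=> aB aC e e0; have e20 : 0 < e / 2 by rewrite divr_gt0.
have [N [S [E [mE muE H]]]] := aB _ e20.
have [N' [S' [E' [mE' muE' H']]]] := aC _ e20.
exists (maxn N N'), (fun s => S (take N s) || S' (take N' s)), (E `|` E').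
split; first exact: measurableU.
  apply: (le_trans (measureU2 _ mE mE')).
  by rewrite [in leRHS](splitr e) EFinD leeD.
move=> w /not_orP[/H BS /H' BS']; rewrite !take_prefix ?leq_maxl ?leq_maxr//.
by split=> [[/BS|/BS'] ->|/orP[/BS|/BS']]; rewrite ?orbT//; [left|right].
Qed.

Lemma approximable0 : approximable set0.
Proof.
move=> e e0; exists 0%N, (fun=> false), set0.
by split => //; rewrite measure0 lee_fin ltW.
Qed.

(** The approximable measurable sets form a sigma-algebra containing the cylinders. A countable
    union is replaced by a finite one missing at most e / 2 of its mass; measurability is carried
    along for this use of continuity from below. *)
Lemma measurable_approximable B : measurable B -> approximable B.
Proof.
suff sub : <<s @cylinders A >> `<=` [set B | measurable B /\ approximable B].
  by move=> /sub[].
clear B.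
apply: smallest_sub => [|_ [s ->]]; last first.
  split; first by apply: sub_sigma_algebra; exists s.
  move=> e e0; exists (size s), (fun t => t == s), set0; split => //.
    by rewrite measure0 lee_fin ltW.
  by move=> w _ /=; split => [->|/eqP].
split.
- by split; [exact: measurable0|exact: approximable0].
- move=> B [mB aB]; rewrite setTD; split; first exact: measurableC.
  exact: approximableC.
move=> F; change (nat -> set (Omega A)) in (type of F) => HF.
have mF n : measurable (F n) by case: (HF n).
split; first exact: bigcupT_measurable.
move=> e e0; have e20 : 0 < e / 2 by rewrite divr_gt0.
pose G n := \big[setU/set0]_(k < n) F k.
have mG n : measurable (G n) by apply: bigsetU_measurable.
have aG n : approximable (G n).
  elim: n => [|n IH]; first by rewrite /G big_ord0; exact: approximable0.
  by rewrite /G big_ord_recr/=; apply: approximableU => //; case: (HF n).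
have UG : \bigcup_n G n = \bigcup_n F n.
  apply/seteqP; split=> w [n _].
    by rewrite /G -bigcup_mkord => -[k _ Fk]; exists k.
  by move=> Fn; exists n.+1 => //; rewrite /G -bigcup_mkord; exists n => /=.
have mU : measurable (\bigcup_n F n) by exact: bigcupT_measurable.
have cvG : mu \o G @ \oo --> mu (\bigcup_n F n).
  rewrite -UG; apply: nondecreasing_cvg_mu => //; first by rewrite UG.
  move=> m n mn; apply/subsetPset; rewrite /G -!bigcup_mkord => w [k /= km Fk].
  by exists k => //=; exact: leq_trans mn.
have Ufin := fin_num_measure mu _ mU.
have lt : (mu (\bigcup_n F n) - (e / 2)%:E < mu (\bigcup_n F n))%E.
  by rewrite -(fineK Ufin) -EFinB lte_fin ltrBlDr ltrDl.
rewrite -[X in (_ < X)%E](cvg_limn_einf_sup cvG).2 in lt.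
have [n _ /= ltn] := limn_esup_gt lt 0%N.
have [N [S [E [mE muE H]]]] := aG n _ e20.
have mD : measurable (\bigcup_n F n `\` G n) by exact: measurableD.
have muD : (mu (\bigcup_n F n) - mu (G n) <= (e / 2)%:E)%E.
  move: ltn; rewrite -(fineK Ufin) -(fineK (fin_num_measure mu _ (mG n))).
  by rewrite -!EFinB lte_fin lee_fin; lra.
exists N, S, (E `|` (\bigcup_n F n `\` G n)); split.
- exact: measurableU.
- apply: (le_trans (measureU2 _ mE mD)).
  rewrite [in leRHS](splitr e) EFinD leeD// measureD//; last first.
    by rewrite ltey_eq Ufin.
  rewrite (_ : _ `&` _ = G n)//.
  by apply/setIidr; rewrite -UG; exact: bigcup_sup.
- move=> w /not_orP[/H GS nD]; rewrite -GS; split=> [Uw|Gw].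
    by apply: contrapT => nG; apply: nD.
  by rewrite -UG; exists n.
Qed.

Lemma finite_rv_approx (I : finType) (Y : Omega A -> I) (e : R) :
  finite_rv Y -> 0 < e ->
  exists N (g : seq A -> I) E, [/\ measurable E, (mu E <= e%:E)%E &
    forall w, ~ E w -> Y w = g (prefix w N)].
Proof.
move=> mY.
suff key (r : seq I) (c : R) : 0 < c ->
    exists N (S : I -> seq A -> bool) E, [/\ measurable E, (mu E <= c%:E)%E &
      forall w i, ~ E w -> i \in r -> (Y w = i <-> S i (prefix w N))].
  move=> e0; have [N [S [E [mE muE H]]]] := key (index_enum I) e e0.
  (* Off [E] exactly one [S i] holds, namely for i = Y w, so the default matters only on [E]. *)
  exists N, (fun s => odflt (Y point) [pick i | S i s]), E; split=> // w nE.
  case: pickP => [i /(H w i nE (mem_index_enum i)) //|/(_ (Y w))].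
  by have /H/(_ (mem_index_enum (Y w)))[->] := nE.
elim: r c => [|i r IH] c c0.
  exists 0%N, (fun _ _ => false), set0.
  by split => //; rewrite measure0 lee_fin ltW.
have c20 : 0 < c / 2 by rewrite divr_gt0.
have [N [S [E [mE muE H]]]] := IH _ c20.
have [N' [S' [E' [mE' muE' H']]]] := measurable_approximable (mY i) c20.
exists (maxn N N'), (fun j s => if j == i then S' (take N' s)
  else S j (take N s)), (E `|` E').
split; first exact: measurableU.
  apply: (le_trans (measureU2 _ mE mE')).
  by rewrite [in leRHS](splitr c) EFinD leeD.
move=> w j /not_orP[nE nE']; rewrite !take_prefix ?leq_maxl ?leq_maxr//.
rewrite in_cons; have [->|ji] /= := eqVneq j i; first by move=> _; exact: H'.
exact: H.
Qed.

Lemma wsum_prod_le1 (I : finType) (a0 : I) n (r : nat -> I -> R) :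
  (forall i a, 0 <= r i a) -> (forall i, \sum_a r i a <= 1) ->
  wsum n (fun u => \prod_(i < n) r i (nth a0 u i)) <= 1.
Proof.
elim: n r => [|n IH] r r0 r1; first by rewrite wsum0 big_ord0.
rewrite wsumS; apply: le_trans (r1 0%N); apply: ler_sum => a _.
rewrite (eq_wsum (g := fun u => r 0%N a *
    \prod_(i < n) r i.+1 (nth a0 u i))); last first.
  by move=> u _; rewrite big_ord_recl.
rewrite wsumM ler_piMr//; apply: (IH (fun i => r i.+1)) => // i; exact: r1.
Qed.

(** * Guessing a label from a window of letters *)

Section approximation.
Context (I : finType) (Y : Omega A -> I) (mY : finite_rv Y).
Context (N : nat) (g : seq A -> I).

Let Y' w := g (prefix w N).
Let YY' w := (Y w, Y' w).

Let mY' : finite_rv Y'.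
Proof.
have -> : Y' = (g \o val) \o itin (@head0 A) N.
  by apply/funext => w; rewrite /Y' -itinerary_head0.
exact: finite_rv_comp (finite_rv_prefix N).
Qed.

Let mYY' : finite_rv YY'.
Proof. exact: finite_rv_pair. Qed.

(** The conditional probability of the label [a] given the guess [b]. Division by 0 yields 0, so for
    a guess of mass 0 the sum over [a] is 0 and not 1; Gibbs' inequality tolerates this. *)
Let r (b a : I) : R := law mu YY' (a, b) / law mu Y' b.

Let r_ge0 b a : 0 <= r b a.
Proof. by rewrite divr_ge0// law_ge0. Qed.

Let law_YY'_le a b : law mu YY' (a, b) <= law mu Y' b.
Proof. exact: (law_le_comp mu snd (a, b) mYY'). Qed.

Let r_sum b : \sum_a r b a <= 1.
Proof.
rewrite /r -mulr_suml.
have -> : \sum_a law mu YY' (a, b) = law mu Y' b.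
  apply: EFin_inj; rewrite -sumEFin -lawE// (measure_finite_rv mu mY)//.
  apply: eq_bigr => a _; rewrite -lawE//; congr (mu _); apply/seteqP.
  by split=> w; rewrite /YY' /=; case=> -> ->.
have [->|b0] := eqVneq (law mu Y' b) 0; first by rewrite mul0r.
by rewrite divff.
Qed.

(* Gibbs' inequality for the joint law of [n] labels and [n + N] letters, compared
   with the law drawing each label independently given its window of [N]
   letters. *)
Lemma block_entropy_approx n :
  block_entropy (block_law mu Y) n <=
  block_entropy (block_law mu (@head0 A)) (n + N) +
  n%:R * (rv_entropy mu YY' - rv_entropy mu Y').
Proof.
pose W w := (itin Y n w, itin (@head0 A) (n + N) w).
have mW : finite_rv W.
  by apply: finite_rv_pair; [exact: finite_rv_itin|exact: finite_rv_prefix].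
pose p := block_law mu (@head0 A).
pose win i (v : seq A) := g (take N (drop i v)).
pose q (x : n.-tuple I * (n + N).-tuple A) : R :=
  p x.2 * \prod_(i < n) r (win i x.2) (nth (Y point) x.1 i).
have pE (v : (n + N).-tuple A) : p v = law mu (snd \o W) v.
  exact: block_lawE.
have p0 (v : (n + N).-tuple A) : 0 <= p v by rewrite pE law_ge0.
have winE i w : (i < n)%N ->
    win i (itin (@head0 A) (n + N) w) = Y' (iter i (@shift A) w).
  move=> ilt; rewrite /win /Y' -itinerary_head0; congr g.
  have -> : itin (@head0 A) (n + N) w =
      itinerary (@head0 A) (i + (N + (n - i))) w :> seq A.
    by rewrite (_ : (i + (N + (n - i)) = n + N)%N)//; lia.
  rewrite itinerary_cat drop_size_cat ?size_mkseq// itinerary_cat.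
  by rewrite take_size_cat// size_mkseq.
have nthE i w : (i < n)%N ->
    nth (Y point) (itin Y n w) i = Y (iter i (@shift A) w).
  exact: nth_mkseq.
pose h (i : 'I_n) (x : n.-tuple I * (n + N).-tuple A) :=
  (nth (Y point) x.1 i, win i x.2).
have hE i : h i \o W = YY' \o iter i (@shift A).
  by apply/funext => w; rewrite /h /W /= winE// nthE.
have law_h i : law mu (h i \o W) = law mu YY' by rewrite hE law_shift.
have lawW_p x : law mu W x <= p x.2 by rewrite pE law_le_comp.
have lawW_h i x : law mu W x <= law mu YY' (h i x).
  by rewrite -(law_h i) law_le_comp.
have qpos x : 0 < law mu W x -> 0 < p x.2 /\
    forall i : 'I_n, 0 < r (win i x.2) (nth (Y point) x.1 i).
  move=> Wx; split=> [|i]; first exact: lt_le_trans (lawW_p x).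
  have J0 := lt_le_trans Wx (lawW_h i x).
  by rewrite divr_gt0// (lt_le_trans J0)// law_YY'_le.
have G : \sum_x law mu W x * log2 (q x) <= \sum_x xlog2 (law mu W x).
  apply: gibbs => [x|x|x qx|].
  - exact: law_ge0.
  - by rewrite mulr_ge0// prodr_ge0.
  - apply/eqP; have := law_ge0 mu W x.
    rewrite le_eqVlt eq_sym => /orP[//|/qpos[px rx]].
    by have : 0 < q x by [rewrite mulr_gt0// prodr_gt0]; rewrite qx ltxx.
  - rewrite sum_law// -(pair_bigA _ (fun u v => q (u, v)))/= exchange_big/=.
    have <- : \sum_(v : (n + N).-tuple A) p v = 1.
      by under eq_bigr do rewrite pE; rewrite sum_law//; exact: finite_rv_comp.
    apply: ler_sum => v _; rewrite /q /= -mulr_sumr ler_piMr//.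
    exact: (@wsum_prod_le1 I (Y point) n (fun i => r (win i v))).
have logq x : law mu W x * log2 (q x) = law mu W x * log2 (p x.2) +
    \sum_(i < n) law mu W x * (log2 (r (h i x).2 (h i x).1)).
  have := law_ge0 mu W x; rewrite le_eqVlt => /orP[/eqP <-|/qpos[px rx]].
    by rewrite !mul0r add0r big1// => i _; rewrite mul0r.
  rewrite /q log2M ?prodr_gt0// mulrDr; congr (_ + _).
  by rewrite -mulr_sumr; congr (_ * _); exact: log2_prod.
have E1 : \sum_x law mu W x * log2 (p x.2) = - block_entropy p (n + N).
  rewrite -(sum_law_comp mu snd (fun v : (n + N).-tuple A => log2 (p v)) mW).
  rewrite opprK.
  by apply: eq_bigr => v _; rewrite -pE xlog2E.
(* By invariance each of the n positions contributes the same conditional entropy H(Y | Y') = H(Y,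
   Y') - H(Y'). *)
have E2 i : \sum_x law mu W x * log2 (r (h i x).2 (h i x).1) =
    - (rv_entropy mu YY' - rv_entropy mu Y').
  rewrite -(sum_law_comp mu (h i) (fun c : I * I => log2 (r c.2 c.1)) mW) law_h.
  rewrite opprB addrC /rv_entropy opprK.
  have -> : \sum_j xlog2 (law mu Y' j) =
      \sum_x law mu YY' x * log2 (law mu Y' x.2).
    rewrite -(sum_law_comp mu snd (fun b => log2 (law mu Y' b)) mYY').
    by apply: eq_bigr => b _; rewrite xlog2E.
  rewrite -sumrB; apply: eq_bigr => -[a b] _ /=; rewrite xlog2E -mulrBr.
  have := law_ge0 mu YY' (a, b); rewrite le_eqVlt => /orP[/eqP <-|J0].
    by rewrite !mul0r.
  have P0 := lt_le_trans J0 (law_YY'_le a b).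
  by rewrite /r log2M ?invr_gt0// log2V.
(* Forgetting the letters can only decrease the entropy. *)
have E3 : \sum_x xlog2 (law mu W x) <= - block_entropy (block_law mu Y) n.
  have := rv_entropy_comp mu fst mW.
  rewrite /rv_entropy lerN2 => /le_trans; apply.
  rewrite opprK le_eqVlt; apply/orP; left; apply/eqP.
  by apply: eq_bigr => u _; rewrite block_lawE.
have := le_trans G E3; under eq_bigr do rewrite logq.
rewrite big_split/= E1 exchange_big/=.
under [X in _ + X]eq_bigr do rewrite E2.
rewrite sumr_const card_ord -[_ *+ n]mulr_natl mulrN -opprD lerN2.
by [].
Qed.

End approximation.

(** Division of the previous bound by n leaves L' <= L + H(Y | Y') for every guess [Y'] made from
    finitely many letters. Along guesses that err with probability tending to 0, H(Y, Y') and H(Y')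
    both tend to H(Y). *)
Lemma generator_bound (I : finType) (Y : Omega A -> I) (L L' : R) :
  finite_rv Y ->
  (fun n => n%:R^-1 * block_entropy (block_law mu Y) n) @ \oo --> L' ->
  (fun n => n%:R^-1 * block_entropy (block_law mu (@head0 A)) n) @ \oo --> L ->
  L' <= L.
Proof.
move=> mY cL' cL.
have sp : stationary (block_law mu (@head0 A)).
  by apply: block_law_stationary => //; exact: finite_rv_head0.
have bound N (g : seq A -> I) (Y' := fun w => g (prefix w N)) :
    L' <= L + (rv_entropy mu (fun w => (Y w, Y' w)) - rv_entropy mu Y').
  set c := _ - _; set HN := block_entropy (block_law mu (@head0 A)) N.
  have cR : (fun n => n%:R^-1 * block_entropy (block_law mu (@head0 A)) n +
      HN / n%:R + c) @ \oo --> L + 0 + c.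
    by apply: cvgD; [apply: cvgD => //; exact: invn_cvg0|exact: cvg_cst].
  rewrite -[L]addr0 -(cvg_lim _ cL')// -[leRHS](cvg_lim _ cR)//.
  apply: ler_lim; [exact: cvgP cL'|exact: cvgP cR|].
  exists 1%N => // n /= n0.
  have nR : 0 < n%:R :> R by rewrite ltr0n.
  rewrite -(ler_pM2l nR) mulrDr [X in X + _]mulrDr mulrA divff ?gt_eqF// mul1r.
  rewrite mulrA divff ?gt_eqF// mul1r mulrCA divff ?gt_eqF// mulr1.
  apply: (le_trans (block_entropy_approx mY N g n)); apply: lerD => //.
  exact: block_entropy_subadd.
have /choice[Ng HNg] : forall n : nat, exists Ng : nat * (seq A -> I),
    exists E, [/\ measurable E, (mu E <= (n.+1%:R^-1 : R)%:E)%E &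
      forall w, ~ E w -> Y w = Ng.2 (prefix w Ng.1)].
  move=> n; have en : 0 < n.+1%:R^-1 :> R by rewrite invr_gt0.
  by have [N [g [E HE]]] := finite_rv_approx mY en; exists (N, g), E.
pose Y' n w := (Ng n).2 (prefix w (Ng n).1).
have mY' n : finite_rv (Y' n).
  have -> : Y' n = ((Ng n).2 \o val) \o itin (@head0 A) (Ng n).1.
    by apply/funext => w; rewrite /Y' -itinerary_head0.
  exact: finite_rv_comp (finite_rv_prefix _).
have cvlaw (J : finType) (X : nat -> Omega A -> J) (X0 : Omega A -> J) :
    (forall n, finite_rv (X n)) -> finite_rv X0 ->
    (forall n w, Y w = Y' n w -> X0 w = X n w) ->
    (fun n => rv_entropy mu (X n)) @ \oo --> rv_entropy mu X0.
  move=> mX mX0 XY; apply: cvgN; apply: cvg_sumr => j.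
  apply: cvg_xlog2 => [n|]; first exact: law_ge0.
  apply/cvgrPdist_le => e e0; near=> n.
  have [E [mE muE HE]] := HNg n.
  apply: (@le_trans _ _ n.+1%:R^-1).
    by apply: (law_dist (E := E)) => // w nE; apply: XY; exact: HE.
  by apply: ltW; near: n; exact: (near_infty_natSinv_lt (PosNum e0)).
have cJ := cvlaw _ (fun n w => (Y w, Y' n w)) (fun w => (Y w, Y w))
  (fun n => finite_rv_pair mY (mY' n)) (finite_rv_pair mY mY)
  (fun n w YY' => congr1 (pair (Y w)) YY').
have cY' := cvlaw _ Y' Y mY' mY (fun n w YY' => YY').
(* Each of the two variables is a function of the other. *)
have EJ : rv_entropy mu (fun w => (Y w, Y w)) = rv_entropy mu Y.
  apply/eqP; rewrite eq_le.
  rewrite (rv_entropy_comp mu (fun i => (i, i)) mY).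
  exact: (rv_entropy_comp mu fst (finite_rv_pair mY mY)).
have cR : (fun n => L + (rv_entropy mu (fun w => (Y w, Y' n w)) -
    rv_entropy mu (Y' n))) @ \oo --> L.
  rewrite -[X in _ --> X]addr0 -[X in _ --> _ + X](subrr (rv_entropy mu Y)).
  by apply: cvgD; [exact: cvg_cst|apply: cvgB => //; rewrite -EJ].
rewrite -(cvg_lim _ cR)//; apply: limr_ge; first exact: cvgP cR.
by apply: nearW => n; exact: bound.
Unshelve. all: by end_near. Qed.

End generator.

(** * Recursive inversion of a coding *)

Section computability.
Local Open Scope nat_scope.

(** The arguments of [PComp] form a nested list, so the hypothesis on them is expressed by
    [List.Forall]. *)
Lemma prf_induction (P : prf -> Prop) :
  P PZero -> P PSucc -> (forall i, P (PProj i)) ->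
  (forall f gs, P f -> List.Forall P gs -> P (PComp f gs)) ->
  (forall f g, P f -> P g -> P (PRec f g)) -> (forall f, P f -> P (PMin f)) ->
  forall e, P e.
Proof.
move=> Pz Ps Pp Pc Pr Pm; fix IH 1; case=> [||i|f gs|f g|f].
- exact: Pz.
- exact: Ps.
- exact: Pp.
- apply: Pc; first exact: IH.
  by elim: gs => [|g gs IHgs]; constructor.
- by apply: Pr; apply: IH.
- by apply: Pm; apply: IH.
Qed.

(** Determinism gives the direction from evaluations to values in [partial_recursive]. For [PMin],
    the smaller of two distinct outputs would be sent both to 0 and to a successor. *)
Lemma prf_eval_inj e v y z : prf_eval e v y -> prf_eval e v z -> y = z.
Proof.
elim/prf_induction: e v y z => [||i|f gs IHf IHgs|f g IHf IHg|f IHf] v y z.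
- by move=> Hy Hz; inversion Hy; inversion Hz.
- by move=> Hy Hz; inversion Hy; inversion Hz.
- by move=> Hy Hz; inversion Hy; inversion Hz.
- move=> Hy Hz; inversion Hy as [| | |? ? ? ws ? Hws Hf| | |]; subst.
  inversion Hz as [| | |? ? ? ws' ? Hws' Hf'| | |]; subst.
  suff E : ws = ws' by subst; exact: IHf Hf Hf'.
  elim: IHgs ws ws' Hws Hws' {Hf Hf' Hy Hz}
    => [|g' gs' IHg' _ IH] ws ws' Hws Hws'.
    by inversion Hws; inversion Hws'.
  inversion Hws; inversion Hws'; subst; congr cons.
    by apply: IHg'; eassumption.
  exact: IH.
- case: v => [|n v] Hy Hz; first by inversion Hy.
  elim: n y z Hy Hz => [|n IHn] y z Hy Hz.
    by inversion Hy; inversion Hz; subst; apply: IHf; eassumption.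
  inversion Hy as [| | | | |? ? ? ? w ? H1 H2|]; subst.
  inversion Hz as [| | | | |? ? ? ? w' ? H1' H2'|]; subst.
  have E := IHn _ _ H1 H1'; subst; exact: IHg H2 H2'.
- move=> Hy Hz; inversion Hy as [| | | | | |? ? ? H1 H2]; subst.
  inversion Hz as [| | | | | |? ? ? H1' H2']; subst.
  case: (ltngtP y z) => // lt.
    by have [k Hk] := H2' _ lt; have := IHf _ _ _ H1 Hk.
  by have [k Hk] := H2 _ lt; have := IHf _ _ _ H1' Hk.
Qed.

Definition computable k (f : seq nat -> nat) : Prop :=
  exists e, forall v, size v = k -> prf_eval e v (f v).

Lemma computable_proj k i : computable k (fun v => List.nth i v 0).
Proof. by exists (PProj i) => v _; constructor. Qed.

Lemma computable_ext k f g : computable k f -> f =1 g -> computable k g.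
Proof. by case=> e He fg; exists e => v vk; rewrite -fg; apply: He. Qed.

Lemma prf_eval_comp1 f g v x y :
  prf_eval g v x -> prf_eval f [:: x] y -> prf_eval (PComp f [:: g]) v y.
Proof. by move=> H1 H2; apply: ev_comp H2; constructor. Qed.

Lemma computable_succ k f : computable k f -> computable k (fun v => (f v).+1).
Proof.
case=> e He; exists (PComp PSucc [:: e]) => v vk.
by apply: prf_eval_comp1 (He _ vk) _; exact: (ev_succ [:: f v]).
Qed.

Lemma computable_const k c : computable k (fun=> c).
Proof.
elim: c => [|c IH]; first by exists PZero => v _; constructor.
exact: (computable_succ IH).
Qed.

Lemma prf_eval_projs (u v : seq nat) :
  List.Forall2 (fun g w => prf_eval g (u ++ v) w)
    [seq PProj i | i <- iota (size u) (size v)] v.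
Proof.
elim: v u => [|x v IH] u /=; first by constructor.
constructor; last by have := IH (rcons u x); rewrite size_rcons cat_rcons.
have := ev_proj (size u) (u ++ x :: v).
by rewrite (_ : List.nth _ _ _ = x)//; elim: u.
Qed.

Lemma computable_weak k f :
  computable k f -> computable k.+2 (fun v => f (drop 2 v)).
Proof.
case=> e He; exists (PComp e [seq PProj i | i <- iota 2 k]).
case=> [|x [|y v]]//= [vk]; rewrite drop0.
apply: ev_comp (He _ vk); rewrite -vk; exact: (prf_eval_projs [:: x; y]).
Qed.

(** In the step function the counter is argument 0 and the accumulator argument 1, ahead of the
    parameters; hence the projections in arity [k.+2] and the uses of [computable_weak] below. *)
Lemma computable_rec k f g h :
  computable k f -> computable k.+2 g -> computable k h ->
  computable k
    (fun v => nat_rect (fun=> nat) (f v) (fun n z => g [:: n, z & v]) (h v)).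
Proof.
move=> [ef Hf] [eg Hg] [eh Hh].
exists (PComp (PRec ef eg) (eh :: [seq PProj i | i <- iota 0 k])) => v vk.
apply: (@ev_comp _ _ _ (h v :: v)).
  constructor; first exact: Hh.
  by rewrite -vk; exact: (prf_eval_projs [::]).
elim: (h v) => [|n IH] /=; first by constructor; apply: Hf.
by apply: ev_recS IH _; apply: Hg => /=; rewrite vk.
Qed.

Lemma computable_pred k f : computable k f -> computable k (fun v => (f v).-1).
Proof.
move=> cf; apply: computable_ext
  (computable_rec (computable_const k 0) (computable_proj k.+2 0) cf) _ => v.
by case: (f v).
Qed.

Lemma computable_add k f g :
  computable k f -> computable k g -> computable k (fun v => f v + g v).
Proof.
move=> cf cg; apply: computable_ext
  (computable_rec cf (computable_succ (computable_proj k.+2 1)) cg) _ => v.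
by elim: (g v) => [|n IH] /=; rewrite ?addn0// addnS -IH.
Qed.

Lemma computable_sub k f g :
  computable k f -> computable k g -> computable k (fun v => f v - g v).
Proof.
move=> cf cg; apply: computable_ext
  (computable_rec cf (computable_pred (computable_proj k.+2 1)) cg) _ => v.
by elim: (g v) => [|n IH] /=; rewrite ?subn0// subnS -IH.
Qed.

Lemma computable_mul k f g :
  computable k f -> computable k g -> computable k (fun v => f v * g v).
Proof.
move=> cf cg; apply: computable_ext
  (computable_rec (computable_const k 0)
    (computable_add (computable_proj k.+2 1) (computable_weak cf)) cg) _ => v.
by elim: (g v) => [|n IH] /=; rewrite ?muln0// mulnS -IH /= drop0 addnC.
Qed.

Lemma computable_exp2 k f : computable k f -> computable k (fun v => 2 ^ f v).
Proof.
move=> cf; apply: computable_ext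
  (computable_rec (computable_const k 1)
    (computable_mul (computable_const k.+2 2) (computable_proj k.+2 1)) cf)
  _ => v.
by elim: (f v) => [|n IH] //=; rewrite expnS -IH.
Qed.

Lemma computable_if0 k f g h :
  computable k f -> computable k g -> computable k h ->
  computable k (fun v => if f v == 0 then g v else h v).
Proof.
move=> cf cg ch; apply: computable_ext
  (computable_rec cg (computable_weak ch) cf) _ => v.
by case: (f v) => //= n; rewrite drop0.
Qed.

Lemma computable_modn k f d :
  0 < d -> computable k f -> computable k (fun v => f v %% d).
Proof.
move=> d0 cf; have cz := computable_succ (computable_proj k.+2 1).
have cif := computable_if0 (computable_sub (computable_const k.+2 d) cz)
  (computable_const k.+2 0) cz.
apply: computable_ext (computable_rec (computable_const k 0) cif cf) _ => v.
elim: (f v) => [|n IH] /=; first by rewrite mod0n.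
rewrite {}IH -[in RHS](addn1 n) -modnDml addn1.
have := ltn_pmod n d0; rewrite leq_eqVlt => /orP[/eqP E|lt].
  by rewrite E subnn modnn.
by rewrite subn_eq0 leqNgt lt /= [RHS]modn_small.
Qed.

Lemma computable_divn k f d :
  0 < d -> computable k f -> computable k (fun v => f v %/ d).
Proof.
move=> d0 cf; have cz := computable_proj k.+2 1.
have cm := computable_modn d0 (computable_succ (computable_proj k.+2 0)).
have cif := computable_if0 cm (computable_succ cz) cz.
apply: computable_ext (computable_rec (computable_const k 0) cif cf) _ => v.
elim: (f v) => [|n IH] /=; first by rewrite div0n.
by rewrite {}IH divnS// /dvdn; case: eqP => _; rewrite ?add1n ?add0n.
Qed.

Lemma computable_table k f (l : seq nat) :
  computable k f -> computable k (fun v => nth 0 l (f v)).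
Proof.
elim: l f => [|x l IH] f cf.
  by apply: computable_ext (computable_const k 0) _ => v; rewrite nth_nil.
apply: computable_ext (computable_if0 cf (computable_const k x)
  (IH _ (computable_pred cf))) _ => v.
by case: (f v).
Qed.

(** * A computable enumeration of the codes of words *)

Section words.
Context (A : finType).
Let K := #|A|.+1.
Let codes := [seq pickle a | a <- enum A].

(* [word_code i n] is the code of the word spelled by the [i] low-order digits of
   [n] in base [#|A| + 1], where the digit 0 is skipped. Codes of words are not
   all of [nat], so the search for a preimage has to run over an enumeration. *)
Definition word_code (i n : nat) : nat :=
  nat_rect (fun=> nat) 0 (fun j c =>
    if (n %/ K ^ j) %% K == 0 then c
    else 2 ^ nth 0 codes ((n %/ K ^ j) %% K).-1 * (c + c).+1) i.

Lemma computable_word_code k f :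
  computable k f -> computable k (fun v => word_code (f v) (f v)).
Proof.
move=> cf.
have K0 : 0 < K by [].
have cshift : computable k.+2 (fun v => f (drop 2 v) %/ K ^ List.nth 0 v 0).
  apply: computable_ext (computable_rec (computable_weak cf)
    (computable_divn K0 (computable_proj k.+4 1))
    (computable_proj k.+2 0)) _ => v.
  elim: (List.nth 0 v 0) => [|j IH] /=; first by rewrite divn1.
  by rewrite {}IH expnSr divnMA.
have cdig := computable_modn K0 cshift.
have cc := computable_proj k.+2 1.
have ctab := computable_exp2 (computable_table codes (computable_pred cdig)).
have cstep := computable_if0 cdig cc
  (computable_mul ctab (computable_succ (computable_add cc cc))).
apply: computable_ext (computable_rec (computable_const k 0) cstep cf) _ => v.
by rewrite /word_code /= drop0.
Qed.

(** Makes the library's encoding of sequences arithmetical, hence accessible to codes of recursive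
    functions. *)
Lemma pickle_cons (a : A) (s : seq A) :
  pickle (a :: s) = 2 ^ pickle a * (pickle s + pickle s).+1.
Proof. by rewrite addnn. Qed.

Lemma word_code_valid i n : exists s : seq A, word_code i n = pickle s.
Proof.
elim: i => [|i [s IH]] /=; first by exists [::].
rewrite /word_code /= -/(word_code i n) IH.
case: eqP => [_|/eqP d0]; first by exists s.
set d := _ %% K in d0 *.
have dlt : d.-1 < size (enum A).
  by rewrite -cardE -ltnS prednK ?lt0n// ltn_pmod.
have a0 : A by case: (enum A) dlt => [|a].
by exists (nth a0 (enum A) d.-1 :: s); rewrite pickle_cons (nth_map a0).
Qed.

(** The witness [num s] has the letters of [s] as nonzero digits, the last letter lowest. Since size
    s <= num s, reading [num s] digits reads all of them. *)
Lemma word_code_surj (s : seq A) : exists n, word_code n n = pickle s.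
Proof.
pose num := fix num (s : seq A) := if s is a :: s' then
  num s' + K ^ size s' * (index a (enum A)).+1 else 0.
have K0 : 0 < K by [].
have idx (a : A) : (index a (enum A)).+1 < K.
  by rewrite ltnS cardE index_mem mem_enum.
have num_lt t : num t < K ^ size t.
  elim: t => [|a t IH]//=; rewrite expnSr.
  apply: (@leq_trans (K ^ size t + K ^ size t * (index a (enum A)).+1)).
    by rewrite ltn_add2r.
  by rewrite -mulnS leq_mul2l idx orbT.
have num_ge t : size t <= num t.
  elim: t => [|a t IH]//=; rewrite -addn1 leq_add//.
  by rewrite muln_gt0 expn_gt0 K0.
(* Arbitrary higher digits [r] are allowed so that the induction can go past the leading letter. *)
have spell t r : word_code (size t) (num t + K ^ size t * r) = pickle t.
  elim: t r => [|a t IH] r //=.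
  rewrite /word_code /= -/(word_code _ _) -addnA expnSr -mulnA -mulnDr IH.
  rewrite divnDr ?dvdn_mulr// divn_small// add0n mulKn ?expn_gt0 ?K0//.
  rewrite addnC mulnC modnMDl modn_small ?idx//= pickle_cons.
  by rewrite (nth_map a) ?index_mem ?mem_enum// nth_index ?mem_enum.
exists (num s); rewrite -{1}(subnKC (num_ge s)).
(* The surplus digits are 0 and are skipped. *)
elim: (num s - size s) => [|j IH].
  by have := spell s 0; rewrite muln0 !addn0.
rewrite addnS /word_code /= -/(word_code _ _) IH.
rewrite divn_small ?mod0n// (leq_trans (num_lt s))// leq_pexp2l//.
exact: leq_addr.
Qed.

End words.

Definition decoder (A : finType) (Z : seq A -> seq bool) (P : seq bool) :
  option (seq A) :=
  if pselect (exists s, Z s = P) is left h then Some (projT1 (cid h)) else None.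

Lemma decoderP (A : finType) (Z : seq A -> seq bool) P s :
  injective Z -> decoder Z P = Some s <-> Z s = P.
Proof.
move=> injZ; rewrite /decoder; case: pselect => [h|h]; last first.
  by split=> // Zs; case: h; exists s.
case: cid => t /= Zt; split=> [[<-]//|Zs]; congr Some.
by apply: injZ; rewrite Zt.
Qed.

(** The code of the inverse minimises over n a test comparing Z (word n) with the input, then
    outputs the word code of the n found. Injectivity of [Z] makes the result independent of which n
    spells the preimage. *)
Lemma partial_recursive_decoder (A : finType) (Z : seq A -> seq bool) :
  reversible_coding Z -> partial_recursive (decoder Z).
Proof.
move=> [injZ [e He]].
have ceval x : prf_eval e [:: pickle x] (pickle (Z x)) by apply/He.
have [eg Hg] := computable_word_code A (computable_proj 1 0).
have [/= word Hword] := choice (fun n => word_code_valid A n n).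
(* [e] is specified on codes of words only. Composed with the enumeration it is total, so the tests
   made before the first success all converge. *)
have cz : computable 2 (fun v => pickle (Z (word (List.nth 0 v 0)))).
  have [eg2 Hg2] := computable_word_code A (computable_proj 2 0).
  exists (PComp e [:: eg2]) => v /Hg2/prf_eval_comp1; apply.
  by rewrite Hword.
have cp := computable_proj 2 1.
(* With truncated subtraction, this sum is the distance of the two codes. *)
have [eT HT] := computable_add (computable_sub cz cp) (computable_sub cp cz).
have T0 n p : prf_eval eT [:: n; p] 0 <-> pickle (Z (word n)) = p.
  split=> [H|<-]; last by have := HT [:: n; pickle (Z (word n))] erefl;
    rewrite /= subnn.
  have /= /esym/eqP := prf_eval_inj H (HT [:: n; p] erefl).
  by rewrite addn_eq0 !subn_eq0 -eqn_leq => /eqP.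
exists (PComp eg [:: PMin eT]) => P y; split.
  move=> H; inversion H as [| | |? ? ? ws ? Hws Hf| | |]; subst.
  inversion Hws as [|? n ? ? Hmin Hnil]; subst; inversion Hnil; subst.
  inversion Hmin as [| | | | | |? ? ? H1 _]; subst.
  exists (word n); split; last first.
    by rewrite -Hword; exact: prf_eval_inj Hf (Hg [:: n] erefl).
  by apply/decoderP => //; apply: (pcan_inj pickleK); apply/T0.
case=> s [/(decoderP _ _ injZ) Zs ->].
have ex : exists n, pickle (Z (word n)) == pickle P.
  have [n Hn] := word_code_surj s; exists n; apply/eqP; congr pickle.
  by rewrite -Zs; congr Z; apply: (pcan_inj pickleK); rewrite -Hword.
case: (ex_minnP ex) => n /eqP Hn nmin.
have -> : s = word n.
  by apply: injZ; rewrite Zs; apply: (pcan_inj pickleK).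
rewrite -Hword; apply: prf_eval_comp1 (Hg [:: n] erefl).
constructor; first exact/T0.
move=> m mn; have /= Hm := HT [:: m; pickle P] erefl.
exists ((pickle (Z (word m)) - pickle P + (pickle P - pickle (Z (word m)))).-1).
rewrite prednK// lt0n addn_eq0 !subn_eq0 -eqn_leq; apply/negP => /nmin.
by rewrite leqNgt mn.
Qed.

Lemma universal_machine_decodes (A : finType) (Z : seq A -> seq bool)
    (C : seq bool -> option (seq A)) :
  reversible_coding Z -> universal_machine C ->
  exists c, forall s, exists2 P, C P = Some s & size P <= c + size (Z s).
Proof.
move=> revZ [_ /(_ _ (partial_recursive_decoder revZ))[p Hp]].
exists (size p) => s; exists (p ++ Z s); last by rewrite size_cat.
by rewrite Hp; apply/decoderP => //; case: revZ.
Qed.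

End computability.

(** * Source coding and Kolmogorov-Sinai entropy *)

Section coding.
Context {R : realType}.

(** At most 2^k codewords have length k, each of weight 2^-k, so each of the B + 1 possible lengths
    contributes at most 1. *)
Lemma sum_injective_code (T : finType) (code : T -> seq bool) (B : nat) :
  injective code -> (forall t, size (code t) <= B)%N ->
  \sum_t (2^-1 : R) ^+ size (code t) <= B.+1%:R.
Proof.
move=> inj sB.
rewrite (partition_big (fun t => inord (size (code t)) : 'I_B.+1) predT)//=.
rewrite -[B.+1 in leRHS]card_ord -sumr_const; apply: ler_sum => k _.
have szE t :
    (inord (size (code t)) == k :> 'I_B.+1) = (size (code t) == k :> nat).
  by rewrite -val_eqE /= inordK// ltnS.
under eq_bigl do rewrite szE.
under eq_bigr => t /eqP -> do [].
rewrite sumr_const -[_ *+ _]mulr_natl exprVn ler_pdivrMr ?exprn_gt0// mul1r.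
rewrite -natrX ler_nat.
pose f (t : T) : k.-tuple bool := [tuple nth false (code t) i | i < k].
rewrite -(card_in_imset (f := f)).
  by apply: (leq_trans (max_card _)); rewrite card_tuple card_bool.
move=> t t'; rewrite !unfold_in => /eqP st /eqP st' ff'; apply: inj.
apply: (@eq_from_nth _ false); rewrite st ?st'// => i ik.
have := congr1 (fun x => tnth x (Ordinal ik)) ff'.
by rewrite !tnth_mktuple.
Qed.

Lemma entropy_le_code (T : finType) (code : T -> seq bool) (B : nat)
    (p : T -> R) :
  injective code -> (forall t, size (code t) <= B)%N ->
  (forall t, 0 <= p t) -> \sum_t p t = 1 ->
  - \sum_t xlog2 (p t) <= \sum_t p t * (size (code t))%:R + log2 B.+1%:R.
Proof.
move=> inj sB p0 p1.
pose q t : R := (2^-1) ^+ size (code t) / B.+1%:R.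
have q0 t : 0 < q t by rewrite divr_gt0// exprn_gt0.
have : \sum_t p t * log2 (q t) <= \sum_t xlog2 (p t).
  apply: gibbs => // [t|t qt|].
  - exact: ltW.
  - by have := q0 t; rewrite qt ltxx.
  - rewrite p1 /q -mulr_suml ler_pdivrMr// mul1r.
    exact: sum_injective_code inj sB.
have logq t : log2 (q t) = - (size (code t))%:R - log2 B.+1%:R :> R.
  by rewrite log2M ?exprn_gt0 ?invr_gt0// log2X// !log2V// log2_2 mulrN1.
under eq_bigr do rewrite logq mulrDr.
rewrite big_split/= -mulr_suml p1 mul1r.
under eq_bigr do rewrite mulrN.
by rewrite sumrN; lra.
Qed.

(** From ln y <= 2 sqrt y at y = M n + 1 <= n^2 * ((M + 1) / n). *)
Lemma log2_sublinear (M : nat) :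
  exists2 e : nat -> R, e @ \oo --> (0 : R) &
    forall n, (0 < n)%N -> log2 (M * n).+1%:R / n%:R <= e n.
Proof.
exists (fun n => 2 / ln 2 * Num.sqrt (M.+1%:R / n%:R)).
  rewrite -[X in _ --> X](mulr0 (2 / ln 2)); apply: cvgMl_tmp.
  rewrite -[X in _ --> X](@sqrtr0 R).
  exact: (continuous_cvg _ (@sqrt_continuous R 0) (@invn_cvg0 R M.+1%:R)).
move=> n n0; have nR : 0 < n%:R :> R by rewrite ltr0n.
have yle : (M * n).+1%:R <= n%:R ^+ 2 * (M.+1%:R / n%:R) :> R.
  rewrite (_ : _ * _ = (n * M.+1)%N%:R); last first.
    by rewrite natrM; field; rewrite gt_eqF.
  by rewrite ler_nat mulnS; lia.
set y : R := (M * n).+1%:R in yle *.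
have y0 : 0 < y by rewrite ltr0n.
have s0 : 0 < Num.sqrt y by rewrite sqrtr_gt0.
have lny : ln y <= 2 * Num.sqrt y.
  have -> : ln y = 2 * ln (Num.sqrt y).
    by rewrite -[in LHS](sqr_sqrtr (ltW y0)) lnXn// mulr_natl.
  by rewrite ler_pM2l// ltW// ln_sublinear.
have sy : Num.sqrt y <= n%:R * Num.sqrt (M.+1%:R / n%:R).
  apply: (le_trans (ler_wsqrtr yle)).
  by rewrite sqrtrM ?exprn_ge0// sqrtr_sqr ger0_norm.
rewrite ler_pdivrMr// /log2 ler_pdivrMr ?ln2_gt0//.
apply: (le_trans lny).
rewrite (_ : _ * ln 2 = 2 * (n%:R * Num.sqrt (M.+1%:R / n%:R))).
  by rewrite ler_pM2l.
by field; rewrite gt_eqF// ln2_gt0.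
Qed.

Lemma AIC_attained (A : finType) (C : seq bool -> option (seq A)) s P :
  C P = Some s -> exists Q, [/\ C Q = Some s, (size Q <= size P)%N &
    AIC (R := R) C s = ((size Q)%:R)%:E].
Proof.
move=> CP.
have ex : exists n, `[< exists2 Q, C Q = Some s & size Q = n >].
  by exists (size P); apply/asboolP; exists P.
case: (ex_minnP ex) => n /asboolP[Q CQ szQ] nmin; exists Q; split => //.
  by rewrite szQ; apply: nmin; apply/asboolP; exists P.
apply/eqP; rewrite eq_le; apply/andP; split.
  by apply: ereal_inf_lbound; exists Q.
apply: le_ereal_inf_tmp => _ [Q' CQ' <-]; rewrite lee_fin ler_nat szQ.
by apply: nmin; apply/asboolP; exists Q'.
Qed.

(** Injectivity holds because [C] recovers [s] from [prog s]. The decoder of [Z], run on [C],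
    supplies some program for every [s], so that [AIC] is finite and attained. *)
Lemma shortest_programs (A : finType) (Z : seq A -> seq bool)
    (C : seq bool -> option (seq A)) :
  reversible_coding Z -> universal_machine C ->
  exists c (prog : seq A -> seq bool), [/\ injective prog,
    forall s, (size (prog s) <= c + size (Z s))%N &
    forall s, AIC (R := R) C s = ((size (prog s))%:R)%:E].
Proof.
move=> revZ univC; have [c Hc] := universal_machine_decodes revZ univC.
have /choice[prog Hprog] : forall s, exists Q,
    [/\ C Q = Some s, (size Q <= c + size (Z s))%N &
        AIC (R := R) C s = ((size Q)%:R)%:E].
  move=> s; have [P CP szP] := Hc s; have [Q [CQ szQ AQ]] := AIC_attained CP.
  by exists Q; split => //; exact: leq_trans szP.
exists c, prog; split => [s t E|s|s]; try by case: (Hprog s).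
by case: (Hprog s) => + _ _; case: (Hprog t) => + _ _; rewrite E => -> [].
Qed.

(** Optimality for blocks of length 1: the empirical entropy is uniformly bounded and the error per
    letter is eventually at most 1. Short words are excluded because the error is controlled only
    asymptotically. *)
Lemma optimal_coding_bound (A : finType) (Z : seq A -> seq bool) :
  optimal_coding (R := R) Z -> exists M n0 : nat,
    forall s, (n0 <= size s)%N -> (size (Z s) <= M * size s)%N.
Proof.
move=> /(_ 1%N isT)[f [f0 Hf]].
have [n0 _ Hn0] : \forall n \near \oo, `|f n / n%:R| <= 1.
  by move/cvgr0_norm_le : f0; apply.
pose B : R := \sum_(w : 1.-tuple A) (2 / ln 2) + 1.
have entB (s : seq A) : emp_entropy 1 s + 1 <= B.
  rewrite /emp_entropy lerD2r invr1 mulN1r -sumrN; apply: ler_sum => w _.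
  have := emp_freq01 R s w; set x := emp_freq s w => x01.
  rewrite (le_trans (ler_norm _))// normrN.
  rewrite (le_trans (xlog2_norm_le x01))// ler_pM2r ?invr_gt0 ?ln2_gt0//.
  rewrite -[leRHS]mulr1 ler_pM2l// -[leRHS](@sqrtr1 R) ler_wsqrtr//.
  by case/andP: x01.
exists (Num.truncn B).+1, n0.+1 => s ns.
have s0 : 0 < (size s)%:R :> R by rewrite ltr0n; apply: leq_trans ns.
rewrite -(ler_nat R) natrM -ler_pdivrMr//.
apply: (le_trans (Hf s)); apply: le_trans (ltW (truncnS_gt B)).
apply: le_trans (entB s); rewrite lerD2l.
by apply: (le_trans (ler_norm _)); apply: Hn0; exact: ltnW.
Qed.

End coding.

(** * Measurability of limits *)

Section limn_measurable.
Context {R : realType}.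
Local Open Scope ereal_scope.

Lemma cvg_of_limn_esup_le (u : nat -> \bar R) :
  limn_esup u <= limn_einf u -> cvgn u.
Proof.
move=> le; apply/cvg_ex; exists (limn_esup u).
have E : limn_einf u = limn_esup u by apply/eqP; rewrite eq_le limn_einf_sup.
apply: (@squeeze_cvge _ _ _ _ (einfs u) u (esups u)).
- apply: nearW => n; apply/andP; split.
    by apply: ereal_inf_lbound; exists n => /=.
  by apply: ereal_sup_ubound; exists n => /=.
- by rewrite -E limn_einf_lim; exact: is_cvg_einfs.
- by rewrite limn_esup_lim; exact: is_cvg_esups.
Qed.

(* Off the set of convergence [limn] is the constant [point]. *)
Lemma measurable_fun_limn d (T : measurableType d) (u : nat -> T -> \bar R) :
  (forall n, measurable_fun setT (u n)) ->
  measurable_fun setT (fun x => limn (u ^~ x)).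
Proof.
move=> mu.
have msup := measurable_fun_limn_esup mu.
have minf : measurable_fun setT (fun x => limn_einf (u ^~ x)).
  have -> : (fun x => limn_einf (u ^~ x)) =
    oppe \o (fun x => limn_esup (fun n => - u n x)) by [].
  apply: measurableT_comp; first exact: oppe_measurable.
  apply: measurable_fun_limn_esup => n.
  by apply: measurableT_comp; first exact: oppe_measurable.
pose b x := limn_esup (u ^~ x) <= limn_einf (u ^~ x).
have -> : (fun x => limn (u ^~ x)) =
    (fun x => if b x then limn_esup (u ^~ x) else point).
  apply/funext => x; case: ifPn => [bx|nbx].
    by rewrite is_cvg_limn_esupE//; exact: cvg_of_limn_esup_le.
  apply: dvgP => cu; move/negP: nbx; apply.
  by rewrite /b is_cvg_limn_esupE// is_cvg_limn_einfE.
apply: measurable_fun_ifT => //.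
exact: measurable_fun_lee.
Qed.

End limn_measurable.

(** * Kolmogorov-Sinai entropy as the block entropy rate *)

Section ks_entropy.
Context (R : realType) (A : FinPointed.type) (mu : probability (Omega A) R).
Context (mu_inv : shift_invariant mu).

Lemma block_entropy_comp (I J : finType) (Y : Omega A -> I) (h : I -> J) n :
  finite_rv Y ->
  block_entropy (block_law mu (h \o Y)) n <= block_entropy (block_law mu Y) n.
Proof.
move=> mY.
have E (K : finType) (X : Omega A -> K) :
    block_entropy (block_law mu X) n = rv_entropy mu (itin X n).
  by congr -%R; apply: eq_bigr => t _; rewrite block_lawE.
have := rv_entropy_comp mu (map_tuple h) (finite_rv_itin n mY).
rewrite !E; congr (rv_entropy _ _ <= _); apply/funext => w; apply: val_inj.
by rewrite /= /itinerary /mkseq -map_comp.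
Qed.

Lemma ks_entropy_part_itin (k : nat) (Y : Omega A -> 'I_k)
    (P : 'I_k -> set (Omega A)) :
  (forall i, P i = Y @^-1` [set i]) -> finite_rv Y ->
  exists2 L : R, ks_entropy_part mu P = L%:E &
    (fun n => n%:R^-1 * block_entropy (block_law mu Y) n) @ \oo --> L.
Proof.
move=> PY mY; have sY := block_law_stationary mu_inv mY.
have [L [cL _]] := fekete (block_entropy_ge0 sY) (block_entropy_subadd sY).
exists L => //; rewrite /ks_entropy_part.
have jE n : @join_iter A k P n = fun t => itin Y n @^-1` [set t].
  apply/funext => t; apply/seteqP; split => w.
    move=> H; apply: eq_from_tnth => i; have := H i I; rewrite PY /= => <-.
    by rewrite (tnth_nth (tnth t i)) nth_mkseq.
  move=> <- i _; rewrite PY /preimage /=.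
  by rewrite (tnth_nth (Y w)) /= nth_mkseq.
rewrite (_ : (fun _ => _) =
    (fun n => (n%:R^-1 * block_entropy (block_law mu Y) n)%:E)).
  by apply: cvg_lim => //; apply: cvg_EFin => //; exact: nearW.
by apply/funext => n; rewrite jE part_entropy_itin.
Qed.

Lemma ks_entropyE (L : R) :
  (fun n => n%:R^-1 * block_entropy (block_law mu (@head0 A)) n) @ \oo --> L ->
  ks_entropy mu = L%:E.
Proof.
move=> cL; apply/eqP; rewrite eq_le; apply/andP; split.
  apply: ge_ereal_sup => _ [k [P [[mP [disjP covP]] ->]]].
  have cov w : exists i, P i w.
    by have : [set: Omega A] w by []; rewrite -covP => -[i _ Pi]; exists i.
  pose Y w := projT1 (cid (cov w)).
  have PY i : P i = Y @^-1` [set i].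
    apply/seteqP; split=> w /=.
      move=> Pi; apply/eqP; apply: contrapT => /negP ne.
      have : (P (Y w) `&` P i) w by split => //; exact: projT2 (cid (cov w)).
      by rewrite disjP.
    by move=> <-; exact: projT2 (cid (cov w)).
  have mY : finite_rv Y by move=> i; rewrite -PY.
  have [L' -> cL'] := ks_entropy_part_itin PY mY.
  by rewrite lee_fin; exact: generator_bound cL' cL.
(* Partitions are indexed by ordinals, so the letters are relabelled; the relabelling is injective
   and loses no entropy. *)
pose Y : Omega A -> 'I_#|A| := enum_rank \o @head0 A.
have mY : finite_rv Y by apply: finite_rv_comp; exact: finite_rv_head0.
have [L' EL' cL'] := ks_entropy_part_itin (fun i => erefl) mY.
apply: (@le_trans _ _ L'%:E).
  rewrite lee_fin -(cvg_lim _ cL)// -[leRHS](cvg_lim _ cL')//.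
  apply: ler_lim; [exact: cvgP cL|exact: cvgP cL'|].
  apply: nearW => n; rewrite ler_wpM2l ?invr_ge0//.
  rewrite (_ : @head0 A = enum_val \o Y); first exact: block_entropy_comp.
  by apply/funext => w; rewrite /= enum_rankK.
apply: ereal_sup_ubound; exists #|A|, (fun i => Y @^-1` [set i]); split => //.
split; first exact: mY.
split.
  move=> i j ij; apply/seteqP; split=> // w [/= Yi Yj].
  by move: ij; rewrite -Yi -Yj eqxx.
by apply/seteqP; split=> // w _; exists (Y w).
Qed.

End ks_entropy.

(** * Comparison of the integrals *)

(** Fatou's lemma for the nonnegative functions [M - u n]. The bound [M] keeps all integrals finite,
    which justifies the subtractions in [\bar R]. *)
Lemma reverse_fatou d (T : measurableType d) (R : realType)
    (mu : probability T R) (u : nat -> T -> R) (M : R) (I : nat -> R) :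
  (forall n, measurable_fun setT (u n)) -> (forall n x, 0 <= u n x <= M) ->
  (forall n, \int[mu]_x (u n x)%:E = (I n)%:E)%E ->
  (limn_esup (fun n => (I n)%:E) <=
   \int[mu]_x limn_esup (fun n => (u n x)%:E))%E.
Proof.
move=> mu_ u0M intu.
pose K x := limn_esup (fun n => (u n x)%:E).
have K0 x : (0 <= K x)%E.
  apply: limn_esup_ge => N; exists N => //.
  by rewrite lee_fin; case/andP: (u0M N x).
have KM x : (K x <= M%:E)%E.
  by apply: limn_esup_le; apply: nearW => n; rewrite lee_fin; case/andP: (u0M n x).
have Kfin x : K x \is a fin_num.
  by rewrite ge0_fin_numE// (le_lt_trans (KM x))// ltry.
pose k x := fine (K x).
have KE x : K x = (k x)%:E by rewrite fineK.
have mK : measurable_fun setT K.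
  by apply: measurable_fun_limn_esup => n; exact/measurable_EFinP.
have mk : measurable_fun setT k.
  exact: (measurableT_comp (fine_measurable measurableT) mK).
have k0M x : 0 <= k x <= M by rewrite -!lee_fin -KE K0 KM.
have iM : (\int[mu]_x (M%:E : \bar R) = M%:E)%E.
  rewrite integral_cst// -[RHS]mule1; congr (_ * _)%E.
  exact: probability_setT.
have diff (g : T -> R) (i : R) : measurable_fun setT g ->
    (forall x, 0 <= g x <= M) -> (\int[mu]_x (g x)%:E = i%:E)%E ->
    (\int[mu]_x (M - g x)%:E = (M - i)%:E)%E.
  move=> mg g0M gi.
  have mMg : measurable_fun setT (fun x => (M - g x)%:E).
    by apply/measurable_EFinP; apply: measurable_funB => //; exact: measurable_cst.
  have mgE : measurable_fun setT (fun x => (g x)%:E) by exact/measurable_EFinP.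
  have g0 x : setT x -> (0 <= (g x)%:E)%E.
    by rewrite lee_fin; case/andP: (g0M x).
  have Mg0 x : setT x -> (0 <= (M - g x)%:E)%E.
    by rewrite lee_fin subr_ge0; case/andP: (g0M x).
  have := ge0_integralD mu measurableT Mg0 mMg g0 mgE.
  rewrite gi; under eq_integral do rewrite -EFinD subrK.
  rewrite iM; case: (\int[mu]_x (M - g x)%:E)%E => [r| |]//.
  by rewrite -EFinD => -[->]; rewrite addrK.
have [i iE] : exists i : R, (\int[mu]_x (k x)%:E = i%:E)%E.
  exists (fine (\int[mu]_x (k x)%:E)%E); rewrite fineK// ge0_fin_numE; last first.
    by apply: integral_ge0 => x _; rewrite lee_fin; case/andP: (k0M x).
  apply: (@le_lt_trans _ _ M%:E); last by rewrite ltry.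
  rewrite -iM; apply: ge0_le_integral => //.
  - by move=> x _; rewrite lee_fin; case/andP: (k0M x).
  - exact/measurable_EFinP.
  - by move=> x _; rewrite lee_fin; case/andP: (k0M x).
have limE (v : nat -> R) : limn_einf (fun n => (M - v n)%:E) =
    (M%:E - limn_esup (fun n => (v n)%:E))%E.
  by rewrite -limn_einfN -limn_einf_shift.
have mb n : measurable_fun setT (fun x => (M - u n x)%:E).
  by apply/measurable_EFinP; apply: measurable_funB => //; exact: measurable_cst.
have b0 n x : setT x -> (0 <= (M - u n x)%:E)%E.
  by rewrite lee_fin subr_ge0; case/andP: (u0M n x).
have := fatou mu measurableT mb b0.
under eq_integral do rewrite limE -/(K _) KE -EFinB.
rewrite (diff _ _ mk k0M iE).
under [X in limn_einf X]eq_fun do rewrite (diff _ _ (mu_ _) (u0M _) (intu _)).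
rewrite limE; under [X in _ -> (_ <= X)%E]eq_integral do rewrite -/(K _) KE.
rewrite iE; case: (limn_esup _) => [r| |]//.
  by rewrite -EFinB !lee_fin; lra.
by rewrite leNye.
Qed.

Section entropies.
Context (R : realType) (A : FinPointed.type) (mu : probability (Omega A) R).
Context (mu_inv : shift_invariant mu).
Implicit Types (w : Omega A).

Definition Hsup w : \bar R := limn_esup (fun l => Hhat_l l w).

Lemma measurable_Hsup : measurable_fun setT Hsup.
Proof. by apply: measurable_fun_limn_esup => l; exact: measurable_Hhat_l. Qed.

Lemma Hsup_ge0 w : (0 <= Hsup w)%E.
Proof. by apply: limn_esup_ge => N; exists N => //; exact: Hhat_l_ge0. Qed.

(** Fekete's lemma for the block entropies of the frequencies at [w]. *)
Lemma ae_Hsup : {ae mu, forall w, Hhat w = Hsup w /\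
  forall l, (0 < l)%N -> (Hsup w <= Hhat_l l w)%E}.
Proof.
have [F [_ _ _ aeF]] := empirical_frequencies mu_inv.
apply: filterS aeF => w [sF HF].
have [L [cL HL]] := fekete (block_entropy_ge0 sF) (block_entropy_subadd sF).
have E : (fun l => Hhat_l l w) = (fun l => (l%:R^-1 * block_entropy (F^~ w) l)%:E).
  exact/funext.
have -> : Hsup w = L%:E by rewrite /Hsup E; exact: limn_esup_cvg.
split; last by move=> l l0; rewrite HF lee_fin HL.
rewrite /Hhat E; apply: cvg_lim => //; apply: cvg_EFin => //.
exact: nearW.
Qed.

Lemma integral_HhatE : (\int[mu]_w Hhat w = \int[mu]_w Hsup w)%E.
Proof.
apply: ae_eq_integral => //.
- by apply: measurable_fun_limn => l; exact: measurable_Hhat_l.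
- exact: measurable_Hsup.
- by apply: filterS ae_Hsup => w [].
Qed.

(** For every positive l, \int Hsup <= \int Hhat_l <= (H_l + 1) / l, and the right-hand side tends
    to [L]. *)
Lemma integral_Hsup_le (L : R) :
  (fun n => n%:R^-1 * block_entropy (block_law mu (@head0 A)) n) @ \oo --> L ->
  (\int[mu]_w Hsup w <= L%:E)%E.
Proof.
move=> cL.
have cR : (fun n => n%:R^-1 * (block_entropy (block_law mu (@head0 A)) n + 1))
    @ \oo --> L.
  rewrite (_ : (fun _ => _) = (fun n =>
    n%:R^-1 * block_entropy (block_law mu (@head0 A)) n + 1 / n%:R)).
    by rewrite -[L]addr0; apply: cvgD => //; exact: invn_cvg0.
  by apply/funext => n; rewrite mulrDr mulr1 mul1r.
rewrite -(limn_esup_cvg cR); apply: limn_esup_ge => N; exists N.+1 => //.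
apply: le_trans (integral_Hhat_l_le mu_inv N.+1).
apply: ae_ge0_le_integral => //.
- by move=> w _; exact: Hsup_ge0.
- exact: measurable_Hsup.
- by move=> w _; exact: Hhat_l_ge0.
- exact: measurable_Hhat_l.
- by apply: filterS ae_Hsup => w [_ H] _; exact: H.
Qed.

Context (Z : seq A -> seq bool) (revZ : reversible_coding Z).
Context (optZ : optimal_coding (R := R) Z).
Context (C : seq bool -> option (seq A)) (univC : universal_machine C).

Lemma K_Z_le_Hhat_l l w : (0 < l)%N -> (K_Z Z w <= Hhat_l (R := R) l w)%E.
Proof.
move=> l0; have [f [f0 Hf]] := optZ l0.
apply: limn_esup_le_add f0; apply: nearW => n.
by have := Hf (prefix w n); rewrite size_mkseq.
Qed.

Lemma K_Z_le_Hsup w : (K_Z Z w <= Hsup w)%E.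
Proof.
apply: limn_esup_ge => N; exists N.+1 => //.
exact: K_Z_le_Hhat_l.
Qed.

Lemma measurable_K_Z : measurable_fun setT (@K_Z R A Z).
Proof.
apply: measurable_fun_limn_esup => n.
exact: (measurable_fun_prefix n (fun s => ((size (Z s))%:R / n%:R)%:E)).
Qed.

Lemma K_Z_ge0 w : (0 <= K_Z (R := R) Z w)%E.
Proof.
by apply: limn_esup_ge => N; exists N => //; rewrite lee_fin divr_ge0.
Qed.

Lemma measurable_K_AIC : measurable_fun setT (@K_AIC R A C).
Proof.
apply: measurable_fun_limn_esup => n.
exact: (measurable_fun_prefix n (fun s => AIC C s * (n%:R^-1)%:E)%E).
Qed.

Lemma K_AIC_le_K_Z w : (K_AIC (R := R) C w <= K_Z Z w)%E.
Proof.
have [c [prog [_ progZ AICE]]] := shortest_programs (R := R) revZ univC.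
rewrite /K_AIC; under eq_fun do rewrite AICE -EFinM.
apply: limn_esup_le_add (@invn_cvg0 R c%:R); apply: nearW => n.
rewrite -mulrDl ler_wpM2r ?invr_ge0// -natrD ler_nat addnC.
exact: progZ.
Qed.

Lemma K_AIC_ge0 w : (0 <= K_AIC (R := R) C w)%E.
Proof.
apply: limn_esup_ge => N; exists N => //; rewrite mule_ge0 ?lee_fin ?invr_ge0//.
by apply: le_ereal_inf_tmp => _ [P _ <-]; rewrite lee_fin.
Qed.

(** Shortest programs on words of length n have lengths at most M n, so [entropy_le_code] loses log2
    (M n + 1), negligible after division by n, and the lengths per letter are dominated by [M]. *)
Lemma integral_K_AIC_ge (L : R) :
  (fun n => n%:R^-1 * block_entropy (block_law mu (@head0 A)) n) @ \oo --> L ->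
  (L%:E <= \int[mu]_w K_AIC C w)%E.
Proof.
move=> cL.
have [c [prog [inj progZ AICE]]] := shortest_programs (R := R) revZ univC.
have [M0 [n0 HM0]] := optimal_coding_bound optZ.
pose M := (c + M0)%N; pose n1 := n0.+1.
have progM n (t : n.-tuple A) : (n1 <= n)%N -> (size (prog t) <= M * n)%N.
  move=> n1n; apply: (leq_trans (progZ t)).
  have := HM0 t; rewrite size_tuple => /(_ (ltnW n1n)).
  by rewrite /M; have : (0 < n)%N by [exact: leq_trans n1n]; nia.
(* Below [n1] the linear bound on program lengths may fail; the value 0 makes the domination by [M]
   hold for all n without changing the limit superior. *)
pose len n (t : n.-tuple A) : R := if (n < n1)%N then 0 else
  (size (prog t))%:R / n%:R.
have len0M n t : 0 <= @len n t <= M%:R.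
  rewrite /len; case: ltnP => [_|n1n]; first by rewrite lexx ler0n.
  have nR : 0 < n%:R :> R by rewrite ltr0n; apply: leq_trans n1n.
  by rewrite divr_ge0//= ler_pdivrMr// -natrM ler_nat progM.
pose u n w := len n (itin (@head0 A) n w).
pose I n : R := \sum_t law mu (itin (@head0 A) n) t * len n t.
have mu_ n : measurable_fun setT (u n).
  exact: (measurable_fun_finite_rv (len n) (finite_rv_prefix n)).
have intu n : (\int[mu]_w (u n w)%:E = (I n)%:E)%E.
  rewrite (integral_finite_rv mu)//; first exact: finite_rv_prefix.
  by move=> t; case/andP: (len0M n t).
have [e e0 He] := log2_sublinear (R := R) M.
apply: (@le_trans _ _ (limn_esup (fun n => (I n)%:E))).
  rewrite -(limn_esup_cvg cL); apply: limn_esup_le_add e0.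
  exists n1 => // n /= n1n.
  have npos : (0 < n)%N by apply: leq_trans n1n.
  have nR : 0 < n%:R :> R by rewrite ltr0n.
  apply: (@le_trans _ _ (I n + log2 (M * n).+1%:R / n%:R)); last first.
    by rewrite lerD2l He.
  rewrite -(ler_pM2l nR) mulrA divff ?gt_eqF// mul1r mulrDr mulrCA divff ?gt_eqF//.
  rewrite mulr1 /I mulr_sumr.
  rewrite (eq_bigr (fun t => law mu (itin (@head0 A) n) t *
      (size (prog t))%:R)); last first.
    move=> t _; rewrite /len ltnNge n1n/= mulrCA; congr (_ * _).
    by rewrite mulrCA divff ?gt_eqF// mulr1.
  rewrite (_ : block_entropy _ n = - \sum_t xlog2 (law mu (itin (@head0 A) n) t)).
    apply: (entropy_le_code (code := fun t : n.-tuple A => prog t)).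
    - by move=> t t' /inj/val_inj.
    - by move=> t; exact: progM.
    - by move=> t; exact: law_ge0.
    - by apply: sum_law; exact: finite_rv_prefix.
  by congr -%R; apply: eq_bigr => t _; rewrite block_lawE.
apply: (le_trans (reverse_fatou mu_ (fun n w => len0M n _) intu)).
apply: ge0_le_integral => //.
- move=> w _; apply: limn_esup_ge => N; exists N => //.
  by rewrite lee_fin; case/andP: (len0M N (itin (@head0 A) N w)).
- by apply: measurable_fun_limn_esup => n; exact/measurable_EFinP.
- exact: measurable_K_AIC.
move=> w _; rewrite /K_AIC; under [X in (_ <= limn_esup X)%E]eq_fun do
  rewrite AICE -EFinM.
apply: limn_esup_le_add (@cvg_cst _ (0 : R) _ \oo _).
exists n1 => // n /= n1n.
by rewrite /= addr0 /u /len ltnNge n1n/= -itinerary_head0.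
Qed.

End entropies.

Local Open Scope ereal_scope.

Theorem theorem3p8 (R : realType) (A : FinPointed.type)
  (mu : probability (Omega A) R) (Hmu : shift_invariant mu)
  (Z : seq A -> seq bool) (HZrev : reversible_coding Z)
  (HZopt : optimal_coding (R := R) Z)
  (C : seq bool -> option (seq A)) (HC : universal_machine C) :
  measurable_fun setT (@K_Z R A Z) /\
  measurable_fun setT (@Hhat R A) /\
  measurable_fun setT (@K_AIC R A C) /\
  ks_entropy mu = \int[mu]_w K_Z Z w /\
  ks_entropy mu = \int[mu]_w Hhat w /\
  ks_entropy mu = \int[mu]_w K_AIC C w.
Proof.
have mKZ := @measurable_K_Z R A Z; have mKA := @measurable_K_AIC R A C.
have mHs := @measurable_Hsup R A.
split; first exact: mKZ.
split; first by apply: measurable_fun_limn => l; exact: measurable_Hhat_l.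
split; first exact: mKA.
have sp := block_law_stationary Hmu (@finite_rv_head0 A).
have [L [cL _]] := fekete (block_entropy_ge0 sp) (block_entropy_subadd sp).
have HK : \int[mu]_w K_AIC C w <= \int[mu]_w K_Z Z w.
  apply: ge0_le_integral => //.
  - by move=> w _; exact: K_AIC_ge0.
  - by move=> w _; exact: K_AIC_le_K_Z.
have KH : \int[mu]_w K_Z Z w <= \int[mu]_w Hsup R w.
  apply: ge0_le_integral => //.
  - by move=> w _; exact: K_Z_ge0.
  - by move=> w _; exact: K_Z_le_Hsup.
have HL := integral_Hsup_le Hmu cL.
have LK := integral_K_AIC_ge HZrev HZopt HC cL.
rewrite (ks_entropyE Hmu cL) (integral_HhatE Hmu); split; [|split];
  apply/eqP; rewrite eq_le.
- by rewrite (le_trans LK HK) (le_trans KH HL).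
- by rewrite (le_trans LK (le_trans HK KH)) HL.
- by rewrite LK (le_trans HK (le_trans KH HL)).
Qed.
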